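(* Let $G=(V,E)$ be a transitive graph of polynomial growth with dimension $d\ge 1$ and suppose that $J:V\times V\to[0,\infty)$ is a transitive kernel with $J(x,y)=\Theta(d_G(x,y)^{-d\alpha})$ with $\alpha\in(1,2)$. Let $\beta>\beta_c$. Then the infinite cluster $K_\infty$ has anchored isoperimetric dimension at most $\max(1/(\alpha-1),d)$ almost surely.
   Context: Graphs are infinite, connected, locally finite and simple. $G=(V,E)$ is transitive if its automorphism group acts transitively on $V$; $o$ is a fixed origin, $d_G$ the graph metric, $B(r)=\{x: d_G(o,x)\le r\}$, and $\#A$ is the cardinality of a set $A$. A transitive graph of polynomial growth has a unique positive integer $d=\dim(G)$, its dimension, for which there are $c_G,C_G>0$ with $c_Gr^d\le \#B(r)\le C_Gr^d$ for all $r\in\mathbb N=\{1,2,\dots\}$. A kernel $J:V\times V\to[0,\infty)$ is symmetric, and it is transitive if $J(\gamma x,\gamma y)=J(x,y)$ for every graph automorphism $\gamma$. $J(x,y)=\Theta(d_G(x,y)^{-d\alpha})$ means there are $c_J,C_J,R_J>0$ with $c_Jd_G(x,y)^{-d\alpha}\le J(x,y)\le C_Jd_G(x,y)^{-d\alpha}$ whenever $d_G(x,y)\ge R_J$. Long-range percolation on $G$ with kernel $J$ and parameter $\beta\ge0$ is the random graph with vertex set $V$ in which each unordered pair of distinct vertices $\{x,y\}$ is an edge independently with probability $1-\exp(-\beta J(x,y))$. Its law is $\mathbf P_\beta$; its connected components are clusters; $K$ is the cluster of $o$; $\beta_c=\inf\{\beta\ge0:\mathbf P_\beta(\#K=\infty)>0\}$;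 for $\beta>\beta_c$, $K_\infty$ is the almost surely unique infinite cluster, regarded as a graph with the open edges. A locally finite connected graph $H$ satisfies an anchored $D$-dimensional isoperimetric inequality if for some (equivalently every) vertex $v$ of $H$ there is $c=c(v)>0$ with $\#\partial_EW\ge c(\#W)^{(D-1)/D}$ for every finite connected set $W$ of vertices of $H$ containing $v$, where $\partial_EW$ is the edge boundary of $W$ in $H$. The anchored isoperimetric dimension of $H$ is the supremum of all $D$ for which $H$ satisfies an anchored $D$-dimensional isoperimetric inequality. *)

(* Defs.v *)
From HB Require Import structures.
From mathcomp Require Import all_boot all_order all_algebra finmap.
From mathcomp Require Import all_classical all_reals all_analysis.

Set Implicit Arguments.
Unset Strict Implicit.
Unset Printing Implicit Defensive.

Import Order.TTheory GRing.Theory Num.Theory.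

Local Open Scope classical_set_scope.
Local Open Scope ring_scope.

Record sgraph (V : choiceType) := SGraph {
  adj :> rel V;
  adj_sym : symmetric adj;
  adj_irr : irreflexive adj }.

HB.instance Definition _ (V : choiceType) := gen_eqMixin (sgraph V).
HB.instance Definition _ (V : choiceType) := gen_choiceMixin (sgraph V).

Definition edgeless (V : choiceType) : sgraph V :=
  @SGraph V (fun _ _ => false) (fun _ _ => erefl) (fun _ => erefl).

HB.instance Definition _ (V : choiceType) :=
  isPointed.Build (sgraph V) (edgeless V).

(* Vertex pairs are unordered: the edge joining x and y is [fset x; y]. *)
Definition pairs (V : choiceType) : set {fset V} :=
  [set e | exists x y : V, x != y /\ e = [fset x; y]%fset].

Definition edges (V : choiceType) (H : sgraph V) : set {fset V} :=
  [set e | exists x y : V, H x y /\ e = [fset x; y]%fset].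

Definition walk (V : choiceType) (H : sgraph V) (n : nat) (x y : V) : Prop :=
  exists p : seq V, [/\ path H x p, last x p = y & size p = n].

Definition reachable (V : choiceType) (H : sgraph V) (x y : V) : Prop :=
  exists n : nat, walk H n x y.

Definition connected_graph (V : choiceType) (H : sgraph V) : Prop :=
  forall x y : V, reachable H x y.

Definition locally_finite (V : choiceType) (H : sgraph V) : Prop :=
  forall x : V, finite_set [set y | H x y].

Definition automorphism (V : choiceType) (H : sgraph V) (g : V -> V) : Prop :=
  bijective g /\ forall x y : V, H (g x) (g y) = H x y.

Definition transitive_graph (V : choiceType) (H : sgraph V) : Prop :=
  forall x y : V, exists2 g : V -> V, automorphism H g & g x = y.

Lemma reachable_ex (V : choiceType) (H : sgraph V) (x y : V) :
  reachable H x y -> exists n : nat, `[< walk H n x y >].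
Proof. by case=> n Hn; exists n; apply/asboolP. Qed.

(* The value 0 for vertices in different components is irrelevant: gdist is
   only used on connected graphs. *)
Definition gdist (V : choiceType) (H : sgraph V) (x y : V) : nat :=
  match pselect (reachable H x y) with
  | left h => ex_minn (reachable_ex h)
  | right _ => 0%N
  end.

Definition gball (V : choiceType) (H : sgraph V) (o : V) (r : nat) : set V :=
  [set x | (gdist H o x <= r)%N].

Definition has_dimension (R : realType) (V : choiceType) (G : sgraph V)
    (o : V) (d : nat) : Prop :=
  exists c C : R, [/\ 0 < c, 0 < C &
    forall r : nat, (0 < r)%N ->
      ((c * r%:R ^+ d)%:E <= counting (gball G o r) /\
       counting (gball G o r) <= (C * r%:R ^+ d)%:E)%E].

Definition transitive_kernel (R : realType) (V : choiceType) (G : sgraph V)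
    (J : V -> V -> R) : Prop :=
  [/\ forall x y : V, 0 <= J x y,
      forall x y : V, J x y = J y x &
      forall g : V -> V, automorphism G g ->
        forall x y : V, J (g x) (g y) = J x y].

Definition kernel_Theta (R : realType) (V : choiceType) (G : sgraph V)
    (J : V -> V -> R) (s : R) : Prop :=
  exists c C r : R, [/\ 0 < c, 0 < C, 0 < r &
    forall x y : V, r <= (gdist G x y)%:R ->
      c * (gdist G x y)%:R `^ s <= J x y <= C * (gdist G x y)%:R `^ s].

(* The sigma-algebra on the set of simple graphs with vertex set V is the one
   generated by the events "the edge between x and y is present", i.e., the
   product sigma-algebra on {0,1}^pairs. *)
Definition adj_events (V : choiceType) : set (set (sgraph V)) :=
  [set A | exists x y : V, A = [set H : sgraph V | H x y]].

HB.instance Definition _ (V : choiceType) :=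
  @isMeasurable.Build (sigma_display (@adj_events V)) (sgraph V)
    <<s @adj_events V >> (@sigma_algebra0 _ setT (@adj_events V))
    (@sigma_algebraC _ (@adj_events V))
    (@sigma_algebra_bigcup _ setT (@adj_events V)).

Definition mutually_independent d (T : measurableType d) (R : realType)
    (P : probability T R) (I : choiceType) (D : set I) (E : I -> set T) :
    Prop :=
  forall F : {fset I}, [set` F] `<=` D ->
    P (\bigcap_(i in [set` F]) E i) = (\prod_(i <- F) P (E i))%E.

Definition percolation_law (R : realType) (V : choiceType) (J : V -> V -> R)
    (beta : R) (P : probability (sgraph V) R) : Prop :=
  mutually_independent P (@pairs V) (fun e => [set H : sgraph V | edges H e])
  /\ forall x y : V, x != y ->
       P [set H : sgraph V | H x y] = (1 - expR (- (beta * J x y)))%:E.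

Definition component (V : choiceType) (H : sgraph V) (x : V) : set V :=
  [set y | reachable H x y].

(* P is the family of percolation laws, indexed by the parameter. *)
Definition beta_c (R : realType) (V : choiceType) (o : V)
    (P : R -> probability (sgraph V) R) : \bar R :=
  ereal_inf [set beta%:E | beta in
    [set b : R | 0 <= b /\
       (0 < P b [set H : sgraph V | infinite_set (component H o)])%E]].

Definition infinite_cluster (V : choiceType) (H : sgraph V) (K : set V) :
    Prop :=
  infinite_set K /\ exists x : V, K = component H x.

Definition subgraph (V : choiceType) (H : sgraph V) (A : set V) : sgraph A :=
  @SGraph A (fun x y => H (val x) (val y))
    (fun x y => adj_sym H (val x) (val y)) (fun x => adj_irr H (val x)).

Definition connected_in (V : choiceType) (H : sgraph V) (W : set V) : Prop :=
  connected_graph (subgraph H W).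

Definition edge_boundary (V : choiceType) (H : sgraph V) (W : set V) :
    set {fset V} :=
  [set e | exists x y : V, [/\ H x y, W x, ~ W y & e = [fset x; y]%fset]].

(* counting takes the value +oo on infinite sets. *)
Definition anchored_isoperimetric (R : realType) (V : choiceType)
    (H : sgraph V) (D : R) : Prop :=
  exists v : V, exists2 c : R, 0 < c &
    forall W : set V, finite_set W -> connected_in H W -> W v ->
      (c%:E * counting W `^ ((D - 1) / D) <= counting (edge_boundary H W))%E.

(* A dimension D is a positive real: (D - 1) / D is meaningless at D = 0. *)
Definition anchored_dimension (R : realType) (V : choiceType) (H : sgraph V) :
    \bar R :=
  ereal_sup [set D%:E | D in
    [set D : R | 0 < D /\ anchored_isoperimetric H D]].

(* Main.v *)
Require Import Defs.
From HB Require Import structures.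
From mathcomp Require Import all_boot all_order all_algebra finmap.
From mathcomp Require Import all_classical all_reals all_analysis.
From mathcomp Require Import measurable_realfun zify lra.

Set Implicit Arguments.
Unset Strict Implicit.
Unset Printing Implicit Defensive.

Import Order.TTheory GRing.Theory Num.Theory.
Local Open Scope classical_set_scope.
Local Open Scope ring_scope.

(** Let B(r) be the ball of radius r about o, and for a vertex v let W_r be the
cluster of v in the percolation configuration restricted to B(r), with N(r)
elements. Every open edge leaving W_r also leaves B(r), whereas W_r depends only
on the edges inside B(r). So, given W_r = A, the number of open edges leaving A
has conditional mean at most S_r(A), the sum of beta J(x,y) over x in A and y
outside B(r) ([percolation_restrict_indep]). Hence the ratio X_r of the number
of boundary edges of W_r to S_r(W_r) + 1/(r+1) has expectation at most 1
([integral_boundary_ratio]), and, almost surely, for every rho < 1 the sum of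
X_r over r in [2^n, 2^(n+1)) is at most a constant times (2/rho)^n
([ae_boundary_ratio_le]).

On the deterministic side, let theta <= 1 and theta < d(alpha - 1). The sum M of
J(x,y) d(x,y)^theta over y is finite and does not depend on x
([weighted_degree_bound]). Of the balls
B(r), m <= r < 2m, at most min(d(x,y), m) <= m^(1 - theta) d(x,y)^theta contain x
but not y, so the sum of S_r(W_r) over these r is at most beta M m^(1 - theta) N(2m)
([sum_escape_le]).

Suppose that the cluster of v satisfies an anchored D-dimensional inequality and
put p = (D - 1)/D. Then X_r (S_r(W_r) + 1/(r+1)) >= c N(r)^p for all large r.
Summing over a dyadic window and using the convexity of x |-> 1/x
([sum_inv_ge]), one gets

    N(2^(n+1)) >= kappa (2^theta rho)^n N(2^n)^p

([cluster_growth]). If D > max(1/(alpha - 1), d), then d/D < min(1, d(alpha-1)),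
so theta and rho can be chosen with theta + log_2 rho > d/D = d(1 - p). The
recursion then forces N(2^n) to grow with an exponent larger than d, whereas
N(2^n) <= #B(2^n) <= C 2^(dn) ([recursion_contradiction]). *)

(** * Walks, distances and balls *)
Section Walks.
Variables (V : choiceType) (H : sgraph V).

Lemma walk0 (x y : V) : walk H 0 x y <-> x = y.
Proof.
split=> [[p [_ lp /eqP]]|->]; last by exists [::].
by rewrite size_eq0 => /eqP p0; rewrite p0 in lp.
Qed.

Lemma walkS (n : nat) (x y : V) :
  walk H n.+1 x y <-> exists2 z, H x z & walk H n z y.
Proof.
split=> [[[|z p] []]// /andP[Hxz pp] lp [sp]|[z Hxz [p [pp lp sp]]]].
  by exists z => //; exists p.
by exists (z :: p); rewrite /= Hxz pp sp.
Qed.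

Lemma walk_cat (m n : nat) (x y z : V) :
  walk H m x y -> walk H n y z -> walk H (m + n) x z.
Proof.
move=> [p [pp lp sp]] [q [qq lq sq]]; exists (p ++ q).
by rewrite cat_path last_cat lp pp qq lq size_cat sp sq.
Qed.

Lemma walk_sym (n : nat) (x y : V) : walk H n x y -> walk H n y x.
Proof.
elim: n x y => [|n IHn] x y; first by rewrite !walk0.
move=> /walkS[z Hxz /IHn w]; rewrite -addn1; apply: (walk_cat w).
by exists [:: x]; rewrite /= adj_sym Hxz.
Qed.

Lemma reachable_refl (x : V) : reachable H x x.
Proof. by exists 0%N; apply/walk0. Qed.

Lemma reachable_adj (x y : V) : H x y -> reachable H x y.
Proof. by move=> Hxy; exists 1%N; exists [:: y]; rewrite /= Hxy. Qed.

Lemma reachable_sym (x y : V) : reachable H x y -> reachable H y x.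
Proof. by move=> [n /walk_sym w]; exists n. Qed.

Lemma reachable_trans (x y z : V) :
  reachable H x y -> reachable H y z -> reachable H x z.
Proof. by move=> [m w] [n w']; exists (m + n)%N; exact: walk_cat w w'. Qed.

(** Induction along a walk that is extended at its far end. *)
Lemma reachable_ind (P : V -> Prop) (x : V) :
    P x -> (forall y z, reachable H x y -> P y -> H y z -> P z) ->
  forall y, reachable H x y -> P y.
Proof.
move=> Px IH y [n w].
have {w}: walk H n y x by exact: walk_sym.
elim: n y => [|n IHn] y; first by rewrite walk0 => ->.
move=> /walkS[z Hyz w]; apply: (IH z); first by exists n; exact: walk_sym.
  exact: IHn.
by rewrite adj_sym.
Qed.

Hypothesis H_connected : connected_graph H.

Lemma gdist_walk (x y : V) : walk H (gdist H x y) x y.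
Proof.
rewrite /gdist; case: pselect => [h|/(_ (H_connected x y))//].
by case: ex_minnP => n /asboolP.
Qed.

Lemma gdist_le (n : nat) (x y : V) : walk H n x y -> (gdist H x y <= n)%N.
Proof.
rewrite /gdist; case: pselect => // h w; case: ex_minnP => m _; apply.
exact/asboolP.
Qed.

Lemma gdist_triangle (x y z : V) :
  (gdist H x z <= gdist H x y + gdist H y z)%N.
Proof. by apply: gdist_le; apply: walk_cat; exact: gdist_walk. Qed.

Lemma walk_automorphism (g : V -> V) (n : nat) (x y : V) :
  automorphism H g -> walk H n (g x) (g y) <-> walk H n x y.
Proof.
move=> [[h gK hK] gH]; elim: n x => [|n IHn] x.
  by rewrite !walk0; split=> [/(can_inj gK)|->].
rewrite !walkS; split=> -[z Hxz w].
  by exists (h z); [rewrite -gH hK|apply/IHn; rewrite hK].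
by exists (g z); [rewrite gH|apply/IHn].
Qed.

Lemma gdist_automorphism (g : V -> V) (x y : V) :
  automorphism H g -> gdist H (g x) (g y) = gdist H x y.
Proof.
move=> gA; apply/eqP; rewrite eqn_leq; apply/andP; split; apply: gdist_le.
  by apply/(walk_automorphism _ _ _ gA); exact: gdist_walk.
by apply/(walk_automorphism _ _ _ gA); exact: gdist_walk.
Qed.

End Walks.

Section Balls.
Variables (R : realType) (V : choiceType) (G : sgraph V) (o : V) (d : nat).
Hypothesis G_dimension : has_dimension R G o d.

Lemma counting_lty (T : choiceType) (A : set T) :
  (counting A < +oo :> \bar R)%E -> finite_set A.
Proof. by rewrite /counting; case: asboolP. Qed.

Lemma gball_finite (r : nat) : finite_set (gball G o r).
Proof.
have [c [C [_ _ bnd]]] := G_dimension.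
apply: (@sub_finite_set _ _ (gball G o r.+1)).
  by move=> x /= /leq_trans; apply.
apply: counting_lty; have [_ /le_lt_trans] := bnd r.+1 isT; apply.
exact: ltry.
Qed.

Lemma countable_vertices : countable [set: V].
Proof.
rewrite (_ : setT = \bigcup_r gball G o r); last first.
  by apply/seteqP; split=> // x _; exists (gdist G o x) => //; exact: leqnn.
by apply: bigcup_countable => // r _; apply/finite_set_countable/gball_finite.
Qed.

End Balls.

(** * Clusters inside a finite set and their edge boundary *)

Section Counting.
Variable R : realType.

Lemma counting_finite (T : choiceType) (A : set T) :
  finite_set A -> counting A = (#|` fset_set A|%:R)%:E :> \bar R.
Proof. by move=> finA; rewrite /counting asboolT. Qed.

Lemma counting_card_le (T U : choiceType) (A : set T) (B : set U) :
  (A #<= B)%card -> (counting A <= counting B :> \bar R)%E.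
Proof.
move=> leAB; have [finB|infB] := pselect (finite_set B); last first.
  by rewrite [leRHS]/counting asboolF// leey.
have finA : finite_set A := card_le_finite leAB finB.
rewrite !counting_finite// lee_fin ler_nat.
have /finite_setP[n Bn] := finB.
rewrite (card_fset_set Bn); apply: geq_card_fset_set.
by rewrite -(card_le_eqr Bn).
Qed.

Lemma counting_esum (T : choiceType) (A : set T) :
  counting A = \esum_(x in A) (1%E : \bar R).
Proof.
have [finA|infA] := pselect (finite_set A).
  rewrite counting_finite// -(set_mem_set A) esum_fset//; last first.
    by rewrite set_mem_set.
  rewrite set_mem_set fsbig_finite//= sumEFin big_const_seq count_predT.
  by rewrite iter_addr addr0 cardfE.
rewrite /counting asboolF//; apply/esym/eq_infty => r.
have [n rn] : exists n, r <= n%:R.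
  by exists (Num.trunc r).+1; exact/ltW/truncnS_gt.
have /infinite_set_fsetP /(_ n)[B BA nB] := infA.
apply: esum_ge; exists [set` B]; first by split.
rewrite fsbig_finite//= sumEFin set_fsetK big_const_seq count_predT.
by rewrite iter_addr addr0 lee_fin (le_trans rn)// ler_nat.
Qed.

End Counting.

(** One half of homogeneity, which suffices for upper bounds. *)
Lemma esum_leZl (R : realType) (T : choiceType) (I : set T) (k : R)
    (a : T -> \bar R) : 0 <= k -> (forall i, 0 <= a i)%E ->
  (\esum_(i in I) (k%:E * a i) <= k%:E * \esum_(i in I) a i)%E.
Proof.
move=> k0 a0; apply: ge_ereal_sup => /= _ [X [finX XI] <-].
rewrite -ge0_mule_fsumr// lee_wpmul2l ?lee_fin// esum_ge//.
by exists X.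
Qed.

(** The vertex set stays [V], so that restriction is a map from the probability
space of graphs on [V] to itself and [component] applies to its values. *)
Definition restrict_to (V : choiceType) (H : sgraph V) (B : {fset V}) : sgraph V.
Proof.
refine (@SGraph V (fun x y => [&& H x y, x \in B & y \in B]) _ _).
- by move=> x y; rewrite adj_sym andbA andbAC -andbA.
- by move=> x; rewrite adj_irr.
Defined.

Section Boundary.
Variables (R : realType) (V : choiceType) (H : sgraph V) (B : {fset V}).

Lemma component_restrict_sub (v : V) :
  v \in B -> component (restrict_to H B) v `<=` [set` B].
Proof. by move=> vB; apply: reachable_ind => // y z _ _ /and3P[]. Qed.

Lemma finite_component_restrict (v : V) :
  v \in B -> finite_set (component (restrict_to H B) v).
Proof.
move=> vB; apply: (sub_finite_set (component_restrict_sub vB)).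
exact: finite_fset.
Qed.

Variables (K : set V) (v : K).
Hypothesis K_closed : forall x y, K x -> H x y -> K y.
Hypothesis v_in : val v \in B.

Let C := component (restrict_to H B) (val v).
Let W := [set y : K | C (val y)].

Lemma component_sub_cluster : C `<=` K.
Proof.
apply: reachable_ind; first exact: set_valP.
by move=> y z _ Ky /and3P[Hyz _ _]; exact: K_closed Ky Hyz.
Qed.

Lemma cluster_component_image : val @` W = C.
Proof.
apply/seteqP; split=> [_ [y Wy <-]//|y Cy].
have Ky := component_sub_cluster Cy.
by exists (SigSub (mem_set Ky)).
Qed.

Lemma cluster_component_finite : finite_set W.
Proof.
apply: finite_preimage (finite_component_restrict v_in).
by move=> x y _ _; exact: val_inj.
Qed.

(** Walks of the restricted graph that start at [v] stay in [W]; they are lifted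
edge by edge to the iterated subgraph. *)
Lemma cluster_component_connected : connected_in (subgraph H K) W.
Proof.
have Wv : W v by exact: reachable_refl.
suff from_v (y : V) : C y -> forall w : W, val (val w) = y ->
    reachable (subgraph (subgraph H K) W) (SigSub (mem_set Wv)) w.
  move=> x y; apply: (@reachable_trans _ _ _ (SigSub (mem_set Wv))).
    by apply: reachable_sym; exact: (from_v _ (set_valP x)).
  exact: (from_v _ (set_valP y)).
move: y; apply: reachable_ind.
  move=> w wv; rewrite (_ : w = SigSub (mem_set Wv)); first exact: reachable_refl.
  by apply: val_inj; exact: val_inj.
move=> y z Cy IH yz w wz.
have Ky := component_sub_cluster Cy.
have Wy : W (SigSub (mem_set Ky)) by [].
apply: (@reachable_trans _ _ _ (SigSub (mem_set Wy))); first exact: IH.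
by apply: reachable_adj => /=; rewrite wz; move: yz => /and3P[].
Qed.

Lemma counting_cluster_component :
  (counting C <= counting W :> \bar R)%E.
Proof.
apply: counting_card_le; rewrite -cluster_component_image.
exact: card_image_le.
Qed.

(** An edge from [C] to a point of [B] outside [C] would enlarge the component, so
the boundary edges of the component all leave [B]. *)
Lemma counting_edge_boundary :
  (counting (edge_boundary (subgraph H K) W) <=
   \esum_(x in C) \esum_(y in ~` [set` B])
     (\1_[set H : sgraph V | H x y] H)%:E :> \bar R)%E.
Proof.
rewrite esum_esum; last by move=> x y _ _; rewrite lee_fin.
pose X := [set p : K * K | [/\ H (val p.1) (val p.2), W p.1 & ~ W p.2]].
pose f (p : K * K) := (val p.1, val p.2).
have WB (x y : K) : W x -> H (val x) (val y) -> ~ W y -> val y \notin B.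
  move=> Wx xy Wy; apply/negP => yB; apply: Wy.
  have xB := component_restrict_sub v_in Wx.
  by apply: reachable_trans Wx _; apply: reachable_adj; rewrite /= xy yB xB.
apply: (@le_trans _ _ (counting X)).
  apply: counting_card_le.
  apply: (@card_le_trans _ _ _ ((fun p => [fset p.1; p.2]%fset) @` X)); last first.
    exact: card_image_le.
  by apply: subset_card_le => _ [x [y [xy Wx Wy ->]]]; exists (x, y).
apply: (@le_trans _ _ (counting (f @` X))).
  apply: counting_card_le.
  have /card_eqPle[_ ] : (f @` X #= X)%card; last by [].
  apply: inj_card_eq => -[x y] [x' y'] _ _ [/val_inj -> /val_inj ->] //.
rewrite counting_esum esum_mkcond [leRHS]esum_mkcond.
apply: le_esum => -[x y] _.
case: ifPn => [/set_mem[[x' y'] /= [xy Wx Wy] [<- <-]]|_]; last first.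
  by case: ifP => // _; rewrite lee_fin.
rewrite mem_set; last by split => //=; apply/negP/(WB _ _ Wx xy Wy).
by rewrite indicE mem_set.
Qed.

End Boundary.

(** * Measurability of clusters and independence of outgoing edges *)

Section EdgeEvents.
Variable V : choiceType.

(** The unordered events of the independence hypothesis are the generators of the
sigma-algebra. *)
Lemma edges_fset2 (H : sgraph V) (x y : V) : edges H [fset x; y]%fset <-> H x y.
Proof.
split=> [[a [b [Hab /fsetP eqxy]]]|Hxy]; last by exists x, y.
have [ab|nab] := eqVneq a b; first by rewrite ab adj_irr in Hab.
have /esym := eqxy a; have /esym := eqxy b; rewrite !inE !eqxx orbT => + /=.
have := eqxy x; have := eqxy y; rewrite !inE !eqxx orbT /=.
move=> /esym/orP[]/eqP yE /esym/orP[]/eqP xE.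
- by rewrite xE yE !orbb eq_sym (negbTE nab).
- by move=> _ _; rewrite xE yE adj_sym.
- by move=> _ _; rewrite xE yE.
- by rewrite xE yE !orbb (negbTE nab).
Qed.

Lemma edges_restrict_to (H : sgraph V) (B e : {fset V}) :
  edges (restrict_to H B) e <-> edges H e /\ (e `<=` B)%fset.
Proof.
split=> [[x [y [/and3P[Hxy xB yB] ->]]]|[[x [y [Hxy ->]]] /fsubsetP eB]].
  split; first exact/edges_fset2.
  by apply/fsubsetP => z; rewrite !inE => /orP[]/eqP ->.
by apply/edges_fset2; rewrite /= Hxy !eB// !inE eqxx ?orbT.
Qed.

Lemma measurable_adj (x y : V) : measurable [set H : sgraph V | H x y].
Proof. by apply: sub_sigma_algebra; exists x, y. Qed.

Lemma measurable_edge (e : {fset V}) :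
  measurable [set H : sgraph V | edges H e].
Proof.
have [[x [y ->]]|ne] := pselect (exists x y, e = [fset x; y]%fset).
  rewrite (_ : mkset _ = [set H : sgraph V | H x y]); first exact: measurable_adj.
  by apply/seteqP; split=> H /edges_fset2.
rewrite (_ : mkset _ = set0)//; apply/seteqP; split=> // H [x [y [_ exy]]].
by apply: ne; exists x, y.
Qed.

Lemma measurable_restrict (B : {fset V}) :
  measurable_fun setT (fun H : sgraph V => restrict_to H B).
Proof.
apply: (@measurability _ _ _ _ _ _ (@adj_events V)) => //.
move=> _ [_ [x [y ->]] <-]; rewrite setTI.
have [/andP[xB yB]|nB] := boolP ((x \in B) && (y \in B)).
  rewrite (_ : _ @^-1` _ = [set H : sgraph V | H x y]); first exact: measurable_adj.
  by apply/seteqP; split=> H /=; rewrite xB yB /= andbT.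
rewrite (_ : _ @^-1` _ = set0)//; apply/seteqP; split=> // H /=.
by rewrite (negbTE nB) andbF.
Qed.

Hypothesis V_countable : countable [set: V].

Lemma measurable_walk (n : nat) (x y : V) :
  measurable [set H : sgraph V | walk H n x y].
Proof.
elim: n x => [|n IHn] x.
  have [->|nxy] := eqVneq x y.
    rewrite (_ : mkset _ = setT)//; apply/seteqP; split=> // H _.
    exact/walk0.
  rewrite (_ : mkset _ = set0)//; apply/seteqP; split=> // H /walk0.
  by move/eqP; rewrite (negbTE nxy).
rewrite (_ : mkset _ =
    \bigcup_z ([set H : sgraph V | H x z] `&` [set H : sgraph V | walk H n z y])).
  apply: countable_bigcupT_measurable => // z.
  by apply: measurableI; [exact: measurable_adj|exact: IHn].
apply/seteqP; split=> H /=; first by move=> /walkS[z]; exists z.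
by move=> [z _ [xz zy]]; apply/walkS; exists z.
Qed.

Lemma measurable_reachable (x y : V) :
  measurable [set H : sgraph V | reachable H x y].
Proof.
rewrite (_ : mkset _ = \bigcup_n [set H : sgraph V | walk H n x y]).
  by apply: bigcupT_measurable => n; exact: measurable_walk.
by apply/seteqP; split=> H /=; [move=> [n]; exists n|move=> [n _]; exists n].
Qed.

Lemma measurable_component (v : V) (A : set V) :
  measurable [set H : sgraph V | component H v = A].
Proof.
rewrite -[mkset _]setCK; apply: measurableC.
rewrite (_ : ~` _ = \bigcup_y (if `[< A y >]
    then ~` [set H : sgraph V | reachable H v y]
    else [set H : sgraph V | reachable H v y])).
  apply: countable_bigcupT_measurable => // y; case: ifP => _.
    by apply: measurableC; exact: measurable_reachable.
  exact: measurable_reachable.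
apply/seteqP; split=> H /=; last first.
  move=> [y _]; case: ifPn => /asboolP Ay.
    by move=> nr eA; rewrite -eA in Ay.
  by move=> r eA; rewrite -eA in Ay.
move=> neq; apply: contrapT => nex; apply: neq.
apply/seteqP; split=> y; [move=> r|move=> Ay]; apply: contrapT => ny; apply: nex;
  exists y => //; first by rewrite asboolF.
by rewrite asboolT.
Qed.

Lemma measurable_component_restrict (B : {fset V}) (v : V) (A : set V) :
  measurable [set H : sgraph V | component (restrict_to H B) v = A].
Proof.
have := measurable_restrict B measurableT (measurable_component v A).
by rewrite setTI.
Qed.

End EdgeEvents.

Section Independence.
Variables (R : realType) (V : choiceType) (J : V -> V -> R) (beta : R).
Variable P : probability (sgraph V) R.
Hypothesis P_law : percolation_law J beta P.

Let edge_events : set (set (sgraph V)) :=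
  [set A | exists F : {fset {fset V}},
    A = \bigcap_(i in [set` F]) [set H : sgraph V | edges H i]].

Let edge_events_setI : setI_closed edge_events.
Proof.
move=> _ _ [F ->] [F' ->]; exists (F `|` F')%fset; rewrite -bigcap_setU.
by rewrite set_fsetU.
Qed.

Let measurable_edge_events : @measurable _ (sgraph V) `<=` <<s edge_events >>.
Proof.
move=> A; apply: smallest_sub; first exact: smallest_sigma_algebra.
move=> _ [x [y ->]]; apply: sub_sigma_algebra; exists [fset [fset x; y]%fset]%fset.
rewrite set_fset1 bigcap_set1.
by apply/seteqP; split=> H /edges_fset2.
Qed.

(** What happens inside [B] is independent of an edge leaving [B]. Both sides are
additive and monotonely continuous in [A], so by Dynkin's theorem it is enough to
take for [A] a finite intersection of edge events, where the product rule
applies. *)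
Lemma percolation_restrict_indep (B : {fset V}) (x y : V)
    (A : set (sgraph V)) : x != y -> y \notin B -> measurable A ->
  P ([set H | A (restrict_to H B)] `&` [set H : sgraph V | H x y]) =
  (P [set H | A (restrict_to H B)] * P [set H : sgraph V | H x y])%E.
Proof.
move=> xy yB mA.

pose E := [set H : sgraph V | H x y].
pose rho (H : sgraph V) := restrict_to H B.
have mE : measurable E by exact: measurable_adj.
have mrho C : measurable C -> measurable (rho @^-1` C).
  by move=> mC; have := measurable_restrict B measurableT mC; rewrite setTI.
pose L := [set C : set (sgraph V) | measurable C /\
  P (rho @^-1` C `&` E) = (P (rho @^-1` C) * P E)%E].
suff sL : <<s edge_events >> `<=` L by have [] := sL _ (measurable_edge_events mA).
apply: lambda_system_subset => //; first split => //.
- by split=> //; rewrite preimage_setT setTI probability_setT mul1e.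
- move=> C D DC [mC hC] [mD hD]; split; first exact: measurableD.
  have -> : rho @^-1` (C `\` D) `&` E =
      (rho @^-1` C `&` E) `\` (rho @^-1` D `&` E).
    apply/seteqP; split=> H /=; first by move=> [[? nD] ?]; split=> // -[].
    by move=> [[? HE] nD]; split=> //; split=> // ?; apply: nD.
  have mCE := measurableI _ _ (mrho _ mC) mE.
  have mDE := measurableI _ _ (mrho _ mD) mE.
  have PD X Y : measurable X -> measurable Y -> Y `<=` X ->
      P (X `\` Y) = (P X - P Y)%E.
    move=> mX mY YX; rewrite measureD ?(setIidr YX)//.
    by rewrite -ge0_fin_numE// fin_num_measure.
  rewrite -[rho @^-1` (C `\` D)]/(rho @^-1` C `\` rho @^-1` D).
  rewrite PD//; last by move=> H [/DC].
  rewrite (PD _ _ (mrho _ mC) (mrho _ mD)); last by move=> H /DC.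
  have fP X : measurable X -> P X \is a fin_num by exact: fin_num_measure.
  rewrite hC hD muleBl//; first exact: fP.
  by apply: fin_num_adde_defr; exact: fP (mrho _ mC).
- move=> F ndF LF; split; first by apply: bigcupT_measurable => n; have [] := LF n.
  have mF n : measurable (rho @^-1` F n) by apply: mrho; have [] := LF n.
  have ndF' : {homo (fun n => rho @^-1` F n) : n m / (n <= m)%N >-> (n <= m)%O}.
    by move=> n m /ndF/subsetPset nm; apply/subsetPset => H; exact: nm.
  have ndFE : {homo (fun n => rho @^-1` F n `&` E) : n m / (n <= m)%N >-> (n <= m)%O}.
    move=> n m /ndF/subsetPset nm; apply/subsetPset => H [Fn HE]; split=> //.
    exact: nm.
  rewrite preimage_bigcup setI_bigcupl.
  apply: cvg_unique (nondecreasing_cvg_mu _ _ ndFE) _ => //.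
  + by move=> n; exact: measurableI.
  + by apply: bigcupT_measurable => n; exact: measurableI.
  rewrite (_ : P \o _ = fun n => P (rho @^-1` F n) * P E)%E; last first.
    by apply/funext => n /=; have [] := LF n.
  apply: cvgeZr; first exact: fin_num_measure.
  by apply: nondecreasing_cvg_mu => //; exact: bigcupT_measurable.
- move=> _ [F ->]; split.
    by apply: fin_bigcap_measurable => // i _; exact: measurable_edge.
  have [FB|] := pselect (forall i, i \in F -> pairs i /\ (i `<=` B)%fset).
    have -> : rho @^-1` (\bigcap_(i in [set` F]) [set H | edges H i]) =
        \bigcap_(i in [set` F]) [set H : sgraph V | edges H i].
      apply/seteqP; split=> H HF i iF; first by have /edges_restrict_to[] := HF i iF.
      by apply/edges_restrict_to; split; [exact: HF|have [] := FB i iF].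
    have xyF : [fset x; y]%fset \notin F.
      apply/negP => /FB[_ /fsubsetP/(_ y)]; rewrite !inE eqxx orbT => /(_ isT).
      by rewrite (negbTE yB).
    have EE : E = [set H : sgraph V | edges H [fset x; y]%fset].
      by apply/seteqP; split=> H /edges_fset2.
    have [ind _] := P_law.
    rewrite EE [X in P X](_ : _ = \bigcap_(i in [set` [fset x; y] |` F]%fset)
      [set H : sgraph V | edges H i]); last by rewrite set_fsetU1 bigcap_setU1 setIC.
    rewrite !ind ?big_fsetU1//=.
    + by rewrite muleC.
    + by move=> i /= /FB[].
    + move=> i /=; rewrite !inE => /orP[/eqP ->|/FB[]//].
      by exists x, y.
  move=> /existsNP[i /not_implyP[iF ni]].
  rewrite (_ : _ @^-1` _ = set0) ?set0I ?measure0 ?mul0e//.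
  apply/seteqP; split=> // H /(_ i iF) /edges_restrict_to[He iB]; apply: ni.
  split=> //; have [a [b [Hab ->]]] := He; exists a, b; split=> //.
  by apply/eqP => ab; rewrite ab adj_irr in Hab.
Qed.

End Independence.

(** * Expected boundary of the cluster inside a finite set *)

Section CountableSums.
Variable R : realType.

(** Sums over a countable set become series, for which the monotone convergence
theorem is available; [None] pads the enumeration. *)
Lemma esum_enum (U : choiceType) (I : set U) : countable I ->
  exists g : nat -> option U, forall a : U -> \bar R, (forall i, 0 <= a i)%E ->
    \esum_(i in I) a i = (\sum_(n <oo) oapp a 0 (g n))%E.
Proof.
move=> /countable_injP[e e_inj].
pose g (n : nat) : option U :=
  if pselect (exists2 i, I i & e i = n) is left h then Some (projT1 (cid2 h))
  else None.
exists g => a a0; rewrite nneseries_esumT; last by move=> n; case: (g n) => //=.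
have ge i : I i -> g (e i) = Some i.
  move=> Ii; rewrite /g; case: pselect => [h|[]]; last by exists i.
  by case: cid2 => j /= Ij ij; congr Some; apply: e_inj; rewrite ?inE.
rewrite [RHS](esumID (e @` I)); last by move=> n _; case: (g n) => /=.
rewrite setTI [X in (_ + X)%E]esum1 ?adde0. 
  rewrite esum_image; last by [].
  by apply: eq_esum => i Ii; rewrite ge.
move=> n [_ nI]; rewrite /g; case: pselect => // h; exfalso; apply: nI.
Qed.

Lemma esum_geo_lty (a z : R) : 0 <= a -> 0 < z < 1 ->
  (\esum_(n in [set: nat]) (a * z ^+ n)%:E < +oo)%E.
Proof.
move=> a0 /andP[z0 z1]; rewrite -nneseries_esumT; last first.
  by move=> n; rewrite lee_fin mulr_ge0// exprn_ge0// ltW.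
apply: (@le_lt_trans _ _ (a / (1 - z))%:E); last exact: ltry.
apply: lime_le.
  apply: is_cvg_nneseries => n _ _.
  by rewrite lee_fin mulr_ge0// exprn_ge0// ltW.
apply: nearW => n; rewrite sumEFin lee_fin.
by apply: geometric_le_lim => //; rewrite gtr0_norm.
Qed.

Lemma esum_ge1 (U : choiceType) (I : set U) (a : U -> \bar R) (i : U) :
  (forall j, 0 <= a j)%E -> I i -> (a i <= \esum_(j in I) a j)%E.
Proof.
move=> a0 Ii; apply: esum_ge; exists [set i]; last by rewrite fsbig_set1.
by split=> // _ ->.
Qed.

Section Integral.
Variables (d : measure_display) (T : measurableType d).
Variable mu : {measure set T -> \bar R}.

Lemma measurable_esum (U : choiceType) (I : set U) (f : U -> T -> \bar R) :
    countable I -> (forall i, measurable_fun setT (f i)) ->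
    (forall i x, 0 <= f i x)%E ->
  measurable_fun setT (fun x => \esum_(i in I) f i x).
Proof.
move=> /esum_enum[g hg] mf f0.
rewrite (_ : (fun x => _) = fun x => (\sum_(n <oo) oapp (f^~ x) 0 (g n))%E).
  apply: ge0_emeasurable_sum => [n x _ _|n _]; case: (g n) => //=.
by apply/funext => x; rewrite hg.
Qed.

Lemma integral_esum (U : choiceType) (I : set U) (f : U -> T -> \bar R) :
    countable I -> (forall i, measurable_fun setT (f i)) ->
    (forall i x, 0 <= f i x)%E ->
  (\int[mu]_x (\esum_(i in I) f i x)%R)%E = \esum_(i in I) (\int[mu]_x f i x)%E.
Proof.
move=> /esum_enum[g hg] mf f0; rewrite hg; last first.
  by move=> i; exact: integral_ge0.
rewrite (eq_integral (fun x => (\sum_(n <oo) oapp (f^~ x) 0 (g n))%E)); last first.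
  by move=> x _; rewrite hg.
rewrite integral_nneseries//; first last.
- by move=> n x _; case: (g n) => /=.
- by move=> n; case: (g n) => //=.
by apply: eq_eseriesr => n _; case: (g n) => //=; rewrite integral0.
Qed.

End Integral.
End CountableSums.

Section BoundaryRatio.
Variables (R : realType) (V : choiceType) (J : V -> V -> R) (beta : R).
Variable P : probability (sgraph V) R.
Hypothesis V_countable : countable [set: V].
Hypothesis beta_ge0 : 0 <= beta.
Hypothesis J_ge0 : forall x y, 0 <= J x y.
Hypothesis P_law : percolation_law J beta P.

(** The number of open edges from [A] to the complement of [B]. *)
Definition crossing (H : sgraph V) (B A : {fset V}) : \bar R :=
  \esum_(x in [set` A]) \esum_(y in ~` [set` B])
    (\1_[set H : sgraph V | H x y] H)%:E.

Definition component_is (B : {fset V}) (v : V) (A : {fset V}) :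
    set (sgraph V) :=
  [set H | component (restrict_to H B) v = [set` A]].

(** The random variable [crossing H B W / q W], where [W] is the component of [v]
in the restriction of [H] to [B]; as a finite sum over the possible values of
[W] it is visibly measurable. *)
Definition boundary_ratio (B : {fset V}) (v : V) (q : {fset V} -> R)
    (H : sgraph V) : \bar R :=
  \sum_(A <- fpowerset B)
    ((q A)^-1%:E * ((\1_(component_is B v A) H)%:E * crossing H B A)).

Lemma crossing_ge0 (H : sgraph V) (B A : {fset V}) : (0 <= crossing H B A)%E.
Proof. by do 2!(apply: esum_ge0 => ? _); rewrite lee_fin. Qed.

Lemma measurable_indic_EFin (E : set (sgraph V)) : measurable E ->
  measurable_fun setT (fun H => (\1_E H : R)%:E).
Proof. by move=> mE; apply/measurable_EFinP; exact: measurable_indic. Qed.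

Lemma countable_sub (A : set V) : countable A.
Proof. exact: sub_countable (subset_card_le (@subsetT _ A)) V_countable. Qed.

Lemma measurable_crossing (B A : {fset V}) :
  measurable_fun setT (fun H => crossing H B A).
Proof.
have m x y := measurable_indic_EFin (measurable_adj x y).
apply: measurable_esum => [|x|x H]; first exact: countable_sub.
  apply: measurable_esum => [|y|y H]; [exact: countable_sub|exact: m|].
  by rewrite lee_fin.
by apply: esum_ge0 => y _; rewrite lee_fin.
Qed.

(** By independence the expectation factorises edge by edge, and
[1 - exp (- beta J) <= beta J]. *)
Lemma integral_component_crossing (B A : {fset V}) (v : V) (q : R) :
    (A `<=` B)%fset ->
    (\esum_(x in [set` A]) \esum_(y in ~` [set` B]) (beta * J x y)%:E <= q%:E)%E ->
  (\int[P]_H ((\1_(component_is B v A) H)%:E * crossing H B A) <=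
   P (component_is B v A) * q%:E)%E.
Proof.
move=> /fsubsetP AB qA; set E := component_is B v A.
have mE : measurable E by exact: measurable_component_restrict.
have mEx x y := measurableI _ _ mE (measurable_adj x y).
have m x y := measurable_indic_EFin (mEx x y).
have -> : (fun H => (\1_E H)%:E * crossing H B A)%E =
    (fun H => \esum_(x in [set` A]) \esum_(y in ~` [set` B])
      (\1_(E `&` [set H : sgraph V | H x y]) H : R)%:E).
  apply/funext => H; have [HE|HE] := pselect (E H).
    rewrite indicE mem_set// mul1e; apply: eq_esum => x _; apply: eq_esum => y _.
    by rewrite indicI /= (indicE _ E) mem_set// mul1r.
  rewrite indicE memNset// mul0e esum1// => x _; rewrite esum1// => y _.
  by rewrite indicI /= (indicE _ E) memNset// mul0r.
rewrite integral_esum; last 3 first.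
- exact: countable_sub.
- move=> x; apply: measurable_esum => [|y|y H]; [exact: countable_sub|exact: m|].
  by rewrite lee_fin.
- by move=> x H; apply: esum_ge0 => y _; rewrite lee_fin.
have PE : (P E \is a fin_num) by exact: fin_num_measure.
apply: (@le_trans _ _ (P E * \esum_(x in [set` A]) \esum_(y in ~` [set` B])
    (beta * J x y)%:E)%E); last by rewrite lee_wpmul2l.
have bJ x y : (0 <= (beta * J x y)%:E)%E by rewrite lee_fin mulr_ge0.
rewrite -(fineK PE).
apply: le_trans (esum_leZl _ _ _); first last.
- by move=> x; apply: esum_ge0.
- by rewrite fine_ge0.
apply: le_esum => x /AB xB.
rewrite integral_esum; last 3 first.
- exact: countable_sub.
- by move=> y; exact: m.
- by move=> y H; rewrite lee_fin.
apply: le_trans (esum_leZl _ _ _) => //; last by rewrite fine_ge0.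
apply: le_esum => y /negP yB.
have xy : x != y by apply: contraNneq yB => <-.
rewrite fineK// integral_indic// setIT.
apply: (@le_trans _ _ (P E * P [set H : sgraph V | H x y])%E).
  rewrite le_eqVlt; apply/orP; left; apply/eqP.
  exact: (percolation_restrict_indep P_law xy yB
    (measurable_component _ v [set` A])).
apply: lee_wpmul2l => //; have [_ ->] := P_law=> //.
by rewrite lee_fin; have := expR_ge1Dx (- (beta * J x y)); lra.
Qed.

Lemma boundary_ratio_ge0 (B : {fset V}) (v : V) (q : {fset V} -> R)
    (H : sgraph V) :
  (forall A, 0 < q A) -> (0 <= boundary_ratio B v q H)%E.
Proof.
move=> q0; apply: sume_ge0 => A _; apply: mule_ge0.
  by rewrite lee_fin invr_ge0 ltW.
by apply: mule_ge0; [rewrite lee_fin|exact: crossing_ge0].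
Qed.

Lemma measurable_boundary_ratio_term (B A : {fset V}) (v : V) :
  measurable_fun setT
    (fun H => ((\1_(component_is B v A) H)%:E * crossing H B A)%E).
Proof.
apply: emeasurable_funM; last exact: measurable_crossing.
by apply: measurable_indic_EFin; exact: measurable_component_restrict.
Qed.

Lemma measurable_boundary_ratio (B : {fset V}) (v : V) (q : {fset V} -> R) :
  measurable_fun setT (boundary_ratio B v q).
Proof.
apply: emeasurable_sum => A; apply: measurable_funeM.
exact: measurable_boundary_ratio_term.
Qed.

(** If [q] dominates the conditional mean of [crossing], the sum over the values
[A] of the component is bounded by the sum of their probabilities. *)
Lemma integral_boundary_ratio (B : {fset V}) (v : V) (q : {fset V} -> R) :
    (forall A, 0 < q A) ->
    (forall A, (A `<=` B)%fset ->
      (\esum_(x in [set` A]) \esum_(y in ~` [set` B]) (beta * J x y)%:E <=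
       (q A)%:E)%E) ->
  (\int[P]_H boundary_ratio B v q H <= 1)%E.
Proof.
move=> q0 qA; have qV A : 0 <= (q A)^-1 by rewrite invr_ge0 ltW.
have t0 A H : (0 <= (\1_(component_is B v A) H)%:E * crossing H B A)%E.
  by apply: mule_ge0; [rewrite lee_fin|exact: crossing_ge0].
rewrite ge0_integral_sum//; last 2 first.
- by move=> A; apply: measurable_funeM; exact: measurable_boundary_ratio_term.
- by move=> A H _; apply: mule_ge0 => //; rewrite lee_fin.
apply: (@le_trans _ _ (\sum_(A <- fpowerset B) P (component_is B v A))%E).
  rewrite big_seq [leRHS]big_seq; apply: lee_sum => A.
  rewrite fpowersetE => AB.
  rewrite ge0_integralZl_EFin//; last exact: measurable_boundary_ratio_term.
  apply: le_trans (lee_wpmul2l _ (integral_component_crossing _ AB (qA A AB))) _.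
    by rewrite lee_fin.
  by rewrite muleCA -EFinM mulVf ?gt_eqF// mule1.
have mE A : measurable (component_is B v A).
  exact: measurable_component_restrict.
rewrite (_ : (\sum_(A <- fpowerset B) _)%E =
    P (\bigcup_(A in [set` fpowerset B]) component_is B v A)).
  by apply: probability_le1; apply: fin_bigcup_measurable.
rewrite measure_fin_bigcup//; last first.
  move=> A A' _ _ [H [eA eA']].
  by rewrite -(set_fsetK A) -eA eA' set_fsetK.
by rewrite fsbig_finite//= set_fsetK.
Qed.

(** The window sums weighted by [rho ^+ n / 2 ^+ n] have a summable expectation, so
almost surely their total is finite and bounds each of them. *)
Lemma ae_boundary_ratio_le (B : nat -> {fset V}) (v : V)
    (q : nat -> {fset V} -> R) (rho : R) :
    0 < rho < 1 -> (forall r A, 0 < q r A) ->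
    (forall r A, (A `<=` B r)%fset ->
      (\esum_(x in [set` A]) \esum_(y in ~` [set` B r]) (beta * J x y)%:E <=
       (q r A)%:E)%E) ->
  {ae P, forall H, exists2 t : R, 0 < t & forall n,
    (\sum_(2 ^ n <= r < 2 ^ n.+1) boundary_ratio (B r) v (q r) H <=
     (t * 2 ^+ n / rho ^+ n)%:E)%E}.
Proof.
move=> /andP[rho0 rho1] q0 qA.
pose w (n : nat) : R := rho ^+ n / 2 ^+ n.
have w0 n : 0 < w n by rewrite divr_gt0// exprn_gt0.
pose X n H := (\sum_(2 ^ n <= r < 2 ^ n.+1) boundary_ratio (B r) v (q r) H)%E.
have X0 n H : (0 <= X n H)%E.
  by apply: sume_ge0 => r _; apply: boundary_ratio_ge0.
have mX n : measurable_fun setT (X n).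
  by apply: emeasurable_sum => r; exact: measurable_boundary_ratio.
have wX0 n H : (0 <= (w n)%:E * X n H)%E.
  by rewrite mule_ge0 ?lee_fin ?(ltW (w0 n)).
have mwX n : measurable_fun setT (fun H => (w n)%:E * X n H)%E.
  exact: measurable_funeM.
pose T H := \esum_(n in [set: nat]) ((w n)%:E * X n H)%E.
have T0 H : (0 <= T H)%E by apply: esum_ge0.
have cN : countable [set: nat] by exact: countableP.
have mT : measurable_fun setT T by exact: measurable_esum.
have iT : (\int[P]_H T H < +oo)%E.
  rewrite integral_esum//.
  have rho01 : 0 < rho < 1 by rewrite rho0.
  apply: (le_lt_trans _ (esum_geo_lty ler01 rho01)).
  apply: le_esum => n _; rewrite mul1r.
  rewrite ge0_integralZl_EFin//; last exact/ltW.
  apply: (@le_trans _ _ ((w n)%:E * (2 ^+ n)%:E)%E).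
    apply: lee_wpmul2l; first by rewrite lee_fin ltW.
    rewrite ge0_integral_sum//; last 2 first.
    - by move=> r; exact: measurable_boundary_ratio.
    - by move=> r H _; apply: boundary_ratio_ge0.
    apply: (@le_trans _ _ (\sum_(2 ^ n <= r < 2 ^ n.+1) 1)%E).
      by apply: lee_sum => r _; apply: integral_boundary_ratio => //; exact: qA.
    rewrite sumEFin lee_fin big_const_nat iter_addr addr0 expnS mul2n -addnn addnK.
    by rewrite natrX.
  by rewrite -EFinM lee_fin /w divfK// gt_eqF// exprn_gt0.
have : P.-integrable setT T.
  apply/integrableP; split=> //.
  by under eq_integral => H _ do rewrite gee0_abs//.
move=> /(integrable_ae measurableT); apply: filterS => H /(_ I) finT.
exists (fine (T H) + 1); first by rewrite ltr_wpDl// fine_ge0.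
move=> n.
have := esum_ge1 (fun n => wX0 n H) (I : [set: nat] n).
rewrite -/(T H) => wXT.
have : ((w n)%:E * X n H <= (fine (T H) + 1)%:E)%E.
  by apply: le_trans wXT _; rewrite -{1}(fineK finT) lee_fin lerDl.
rewrite -lee_pdivlMl// => /le_trans; apply.
by rewrite -EFinM lee_fin /w invf_div mulrC mulrA.
Qed.

End BoundaryRatio.

(** * Real inequalities and a growth recursion *)

Lemma esum_exchange (R : realType) (U W : choiceType) (Q : U -> W -> Prop)
    (a : U -> W -> \bar R) : (forall i j, 0 <= a i j)%E ->
  \esum_(i in [set: U]) \esum_(j in [set j | Q i j]) a i j =
  \esum_(j in [set: W]) \esum_(i in [set i | Q i j]) a i j.
Proof.
move=> a0; rewrite !esum_esum//.
rewrite (@reindex_esum R _ _ ([set: W] `*`` (fun j => [set i | Q i j])) _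
  (fun k => (k.2, k.1)))//; split.
- by move=> [j i] [].
- by move=> [j i] [j' i'] _ _ [-> ->].
- by move=> [i j] [_ Qij]; exists (j, i).
Qed.

Section RealLemmas.
Variable R : realType.

(** The number of radii in a window at which a pair at distances [a] and [b] from
the centre is separated by the ball. *)
Lemma sum_window_le (m n a b : nat) :
  (\sum_(m <= r < n) (a <= r < b) <= minn n b - a)%N.
Proof.
elim: n => [|n IHn]; first by rewrite big_geq.
have [mn|nm] := leqP m n; last by rewrite big_geq.
rewrite big_nat_recr//=; case: (leqP a n) => an; case: (ltnP n b) => nb; lia.
Qed.

(** Geometric interpolation between the two bounds on the minimum. *)
Lemma min_le_powR (theta x y : R) : 0 <= theta <= 1 -> 0 <= x -> 0 < y ->
  Num.min x y <= y `^ (1 - theta) * x `^ theta.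
Proof.
move=> /andP[t0 t1] x0 y0; have t1' : 0 <= 1 - theta by rewrite subr_ge0.
have split_powR (z : R) : 0 < z -> z = z `^ (1 - theta) * z `^ theta.
  by move=> z0; rewrite -powRD ?subrK ?powRr1// ?(ltW z0)// (gt_eqF z0) implybT.
have [xy|yx] := leP x y.
  move: x0; rewrite le_eqVlt => /predU1P[<-|x0].
    by rewrite mulr_ge0// powR_ge0.
  rewrite [leLHS]split_powR// ler_wpM2r ?powR_ge0//.
  by rewrite ge0_ler_powR// nnegrE ltW.
rewrite [leLHS]split_powR// ler_wpM2l ?powR_ge0//.
by rewrite ge0_ler_powR// ?nnegrE ?ltW// (lt_trans y0).
Qed.

(** A convex function lies above its tangent, here at the point [w^-1]. *)
Lemma inv_ge_tangent (x w : R) : 0 < x -> 2 * w - w ^+ 2 * x <= x^-1.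
Proof.
move=> x0; have : 0 <= x * (x^-1 - w) ^+ 2 by rewrite mulr_ge0 ?sqr_ge0// ltW.
have : x * x^-1 = 1 by rewrite mulfV// gt_eqF.
move: x^-1 => v xv h; have e1 : x * v * v = v by rewrite xv mul1r.
have e2 : x * v * w = w by rewrite xv mul1r.
lra.
Qed.

(** The inequality between arithmetic and harmonic means, through the tangent at
[lambda]. *)
Lemma sum_inv_ge (I : Type) (s : seq I) (q : I -> R) (lambda : R) :
    (forall i, 0 < q i) -> 0 < lambda ->
    \sum_(i <- s) q i <= (size s)%:R * lambda ->
  (size s)%:R / lambda <= \sum_(i <- s) (q i)^-1.
Proof.
move=> q0 l0 ql.
set w := lambda^-1.
have lw : lambda * w = 1 by rewrite mulfV// gt_eqF.
have w0 : 0 < w by rewrite invr_gt0.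
apply: le_trans (ler_sum _ (fun i _ => inv_ge_tangent w (q0 i))).
have -> : \sum_(i <- s) (2 * w - w ^+ 2 * q i) =
    (size s)%:R * (2 * w) - w ^+ 2 * \sum_(i <- s) q i.
  rewrite sumrB mulr_sumr; congr (_ - _).
  by rewrite big_const_seq count_predT iter_addr addr0 [RHS]mulr_natl.
have : w ^+ 2 * \sum_(i <- s) q i <= w ^+ 2 * ((size s)%:R * lambda).
  by rewrite ler_wpM2l// sqr_ge0.
have -> : w ^+ 2 * ((size s)%:R * lambda) = (size s)%:R * w.
  by rewrite mulrCA expr2 -mulrA (mulrC w lambda) lw mulr1.
by lra.
Qed.

(** With [L n = ln (u n)] the recursion reads
[L n.+1 >= p * L n + n * ln mu + ln kappa]; it has the linear subsolution of slope
[ln mu / (1 - p)], which is steeper than the upper bound [d * ln 2]. *)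
Lemma recursion_contradiction (u : nat -> R) (n0 d : nat) (C kappa mu p : R) :
    0 < C -> 0 < kappa -> 0 < mu -> 0 <= p < 1 ->
    (1 - p) * (d%:R * ln 2) < ln mu ->
    (forall n, (n0 <= n)%N -> 1 <= u n <= C * (2 ^+ n) ^+ d) ->
    (forall n, (n0 <= n)%N -> kappa * mu ^+ n * u n `^ p <= u n.+1) ->
  False.
Proof.
move=> C0 kappa0 mu0 /andP[p0 p1] mu_gt u_bnd u_rec.
have q0 : 0 < 1 - p by rewrite subr_gt0.
pose s := ln mu / (1 - p).
have sE : p * s + ln mu = s.
  have : s * (1 - p) = ln mu by rewrite /s divfK// gt_eqF.
  by lra.
have s_gt : d%:R * ln 2 < s by rewrite /s ltr_pdivlMr// mulrC.
have ln2 : 0 < ln 2 :> R by rewrite ln_gt0// ltr1n.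
have s0 : 0 < s by apply: le_lt_trans s_gt; rewrite mulr_ge0// ltW.
(* The first term gives the initial condition, the second one the induction step
   of the bound [s * n - t <= ln (u n)]. *)
pose t := s * n0%:R + `|s - ln kappa| / (1 - p).
have t1 : s - ln kappa <= t * (1 - p).
  rewrite /t mulrDl divfK ?gt_eqF// (le_trans (ler_norm _))// lerDr.
  by apply: mulr_ge0; [apply: mulr_ge0|]; rewrite ?ler0n ?ltW.
have u0 n : (n0 <= n)%N -> 0 < u n.
  by move=> /u_bnd/andP[u1 _]; exact: lt_le_trans u1.
have lower k : s * (n0 + k)%:R - t <= ln (u (n0 + k)%N).
  elim: k => [|k IHk].
    rewrite addn0 (le_trans (_ : _ <= 0))//; last first.
      by rewrite ln_ge0//; have /andP[] := u_bnd n0 (leqnn _).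
    by rewrite subr_le0 /t lerDl divr_ge0// ltW.
  have nk : (n0 <= n0 + k)%N by exact: leq_addr.
  rewrite addnS; apply: (@le_trans _ _
    (ln (kappa * mu ^+ (n0 + k) * u (n0 + k)%N `^ p))).
    rewrite lnM ?posrE ?mulr_gt0 ?exprn_gt0 ?powR_gt0 ?u0//.
    rewrite lnM ?posrE ?exprn_gt0// lnXn// ln_powR -mulr_natl.
    move: IHk; rewrite -natr1; set x := (n0 + k)%:R => IHk.
    have : p * (s * x - t) <= p * ln (u (n0 + k)%N) by rewrite ler_wpM2l.
    have : p * s * x + x * ln mu = s * x.
      by rewrite (mulrC x) -mulrDl sE.
    by move: t1; lra.
  rewrite ler_ln ?posrE ?mulr_gt0 ?exprn_gt0 ?powR_gt0 ?u0//; last first.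
    by rewrite leqW.
  exact: u_rec.
have upper k : ln (u (n0 + k)%N) <= ln C + (n0 + k)%:R * (d%:R * ln 2).
  have /andP[_ uC] := u_bnd (n0 + k)%N (leq_addr _ _).
  apply: (@le_trans _ _ (ln (C * (2 ^+ (n0 + k)) ^+ d))).
    by rewrite ler_ln// posrE ?u0 ?leq_addr// mulr_gt0// !exprn_gt0.
  rewrite lnM ?posrE ?exprn_gt0// lnXn ?exprn_gt0// lnXn//.
  by rewrite !mulr_natl -!mulrnA mulnC.
pose gap := s - d%:R * ln 2.
have gap0 : 0 < gap by rewrite subr_gt0.
pose k := (Num.trunc ((ln C + t) / gap)).+1.
have : (ln C + t) / gap < (n0 + k)%:R.
  rewrite (lt_le_trans (truncnS_gt _))// ler_nat; exact: leq_addl.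
rewrite ltr_pdivrMr//.
by have := le_trans (lower k) (upper k); rewrite /gap; lra.
Qed.

End RealLemmas.

(** * The weighted degree *)

Section WeightedDegree.
Variables (R : realType) (V : choiceType) (G : sgraph V) (o : V) (d : nat).
Variables (J : V -> V -> R) (alpha : R).
Hypothesis G_connected : connected_graph G.
Hypothesis G_transitive : transitive_graph G.
Hypothesis G_dimension : has_dimension R G o d.
Hypothesis J_transitive : transitive_kernel G J.
Hypothesis J_Theta : kernel_Theta G J (- (d%:R * alpha)).

Let J_ge0 x y : 0 <= J x y. Proof. by have [] := J_transitive. Qed.

(** Replaces a distance by the lower end of its dyadic interval. *)
Lemma powR_dyadic_le (s : R) (k : nat) : 0 <= s -> (0 < k)%N ->
  k%:R `^ (- s) <= (2 `^ (- s)) ^+ trunc_log 2 k.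
Proof.
move=> s0 k0; have k0' : 0 < k%:R :> R by rewrite ltr0n.
rewrite -powR_mulrn ?powR_ge0// -powRrM mulrC powRrM powR_mulrn//.
rewrite !powRN lef_pV2 ?posrE ?powR_gt0 ?exprn_gt0//.
rewrite ge0_ler_powR ?nnegrE ?exprn_ge0//.
by rewrite -natrX ler_nat trunc_logP.
Qed.

(** The dyadic shell of index [j] has at most [C * 2 ^+ (j.+1 * d)] points and
contributes at most [2 `^ (- s * j)] per point, so the sum is dominated by a
geometric series of ratio [2 `^ (d - s)]. *)
Lemma esum_gdist_powR_lty (s : R) : d%:R < s ->
  (\esum_(y in [set y | (0 < gdist G o y)%N]) ((gdist G o y)%:R `^ (- s))%:E
    < +oo)%E.
Proof.
move=> ds; have s0 : 0 <= s by apply: ltW; apply: le_lt_trans ds.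
have [c [C [_ C0 bnd]]] := G_dimension.
pose z : R := 2 `^ (- s).
have z0 : 0 < z by exact: powR_gt0.
pose Q (y : V) (j : nat) := (gdist G o y <= 2 ^ j.+1)%N.
apply: (@le_lt_trans _ _
  (\esum_(y in [set: V]) \esum_(j in [set j | Q y j]) (z ^+ j)%:E)%E).
  rewrite esum_mkcond; apply: le_esum => y _; case: ifPn => [/set_mem/= y0|_].
    pose j := trunc_log 2 (gdist G o y).
    apply: (@le_trans _ _ (z ^+ j)%:E).
      by rewrite lee_fin; exact: powR_dyadic_le.
    apply: (@esum_ge1 _ _ _ (fun j => (z ^+ j)%:E) j) => [k|].
      by rewrite lee_fin exprn_ge0// ltW.
    exact/ltnW/trunc_log_ltn.
  by apply: esum_ge0 => j _; rewrite lee_fin exprn_ge0// ltW.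
rewrite esum_exchange; last by move=> y j; rewrite lee_fin exprn_ge0// ltW.
apply: (@le_lt_trans _ _
  (\esum_(j in [set: nat]) (C * 2 ^+ d * (z * 2 ^+ d) ^+ j)%:E)%E).
  apply: le_esum => j _.
  have zj0 : 0 <= z ^+ j by rewrite exprn_ge0// ltW.
  under eq_esum => y _ do rewrite -(mule1 (z ^+ j)%:E).
  have one_ge0 (y : V) : (0 <= 1 :> \bar R)%E by rewrite lee_fin.
  apply: (le_trans (esum_leZl [set y | Q y j] zj0 one_ge0)).
  rewrite -counting_esum.
  have j2 : (0 < 2 ^ j.+1)%N by rewrite expn_gt0.
  have [_ le_ball] := bnd _ j2.
  apply: (@le_trans _ _ ((z ^+ j)%:E * (C * (2 ^ j.+1)%:R ^+ d)%:E)%E).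
    by apply: lee_wpmul2l; rewrite ?lee_fin.
  rewrite -EFinM lee_fin natrX exprS !exprMn -!exprM (mulnC d j).
  by rewrite mulrCA (mulrCA (z ^+ j) (2 ^+ d)) -[leRHS]mulrA.
apply: esum_geo_lty; first by rewrite mulr_ge0 ?exprn_ge0// ltW.
rewrite mulr_gt0 ?exprn_gt0//=.
rewrite /z powRN mulrC ltr_pdivrMr ?powR_gt0// mul1r -powR_mulrn//.
by rewrite -ltr_ln ?posrE ?powR_gt0// !ln_powR ltr_pM2r// ln_gt0// ltr1n.
Qed.

(** By transitivity the sum is the same at all vertices. At [o], the finitely many
points where the asymptotics of [J] does not apply give a finite sum, and the
others are controlled by [esum_gdist_powR_lty] with [s = d * alpha - theta]. *)
Lemma weighted_degree_bound (theta : R) :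
    0 < theta < d%:R * (alpha - 1) ->
  exists2 M : R, 0 <= M & forall x,
    (\esum_(y in [set: V]) (J x y * (gdist G x y)%:R `^ theta)%:E <= M%:E)%E.
Proof.
move=> /andP[theta0 theta1].
pose F x y := (J x y * (gdist G x y)%:R `^ theta)%:E.
have F0 x y : (0 <= F x y)%E by rewrite lee_fin mulr_ge0// powR_ge0.
have [_ _ J_aut] := J_transitive.
have F_const x : \esum_(y in [set: V]) F x y = \esum_(y in [set: V]) F o y.
  have [g gA <-] := G_transitive o x; have [g_bij _] := gA.
  rewrite (@reindex_esum _ _ _ [set: V] [set: V] g); last first.
    by rewrite setTT_bijective.
  by apply: eq_esum => y _; rewrite /F J_aut// gdist_automorphism.
suff : (\esum_(y in [set: V]) F o y < +oo)%E.
  have S0 : (0 <= \esum_(y in [set: V]) F o y)%E by apply: esum_ge0.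
  move=> Sfin; exists (fine (\esum_(y in [set: V]) F o y)); first exact: fine_ge0.
  by move=> x; rewrite [leLHS]F_const fineK// ge0_fin_numE.
have [c [C [r [_ C0 r0 J_bnd]]]] := J_Theta.
pose m := (Num.trunc r).+1.
have rm : r < m%:R by exact: truncnS_gt.
have m0 : (0 < m)%N by rewrite -(ltr0n R) (lt_trans r0).
rewrite (esumID (gball G o m))// !setTI lte_add_pinfty//.
  have finB := gball_finite G_dimension m.
  rewrite -(set_mem_set (gball G o m)) esum_fset//; last by rewrite set_mem_set.
  rewrite set_mem_set fsbig_finite// sumEFin; exact: ltry.
pose s := d%:R * alpha - theta.
apply: (@le_lt_trans _ _ (C%:E * \esum_(y in [set y | (0 < gdist G o y)%N])
    ((gdist G o y)%:R `^ (- s))%:E)%E); last first.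
  have fin : (\esum_(y in [set y | (0 < gdist G o y)%N])
    ((gdist G o y)%:R `^ (- s))%:E < +oo)%E.
    by apply: esum_gdist_powR_lty; rewrite /s; lra.
  have ge0 : (0 <= \esum_(y in [set y | (0 < gdist G o y)%N])
    ((gdist G o y)%:R `^ (- s))%:E)%E.
    by apply: esum_ge0 => y _; rewrite lee_fin powR_ge0.
  by apply: lte_mul_pinfty => //; rewrite lee_fin ltW.
apply: le_trans (esum_leZl _ (ltW C0) _); last first.
  by move=> y; rewrite lee_fin powR_ge0.
rewrite esum_mkcond [leRHS]esum_mkcond; apply: le_esum => y _.
case: ifPn => [/set_mem/= /negP|_]; last first.
  by case: ifP => // _; rewrite -EFinM lee_fin mulr_ge0 ?powR_ge0 ?ltW.
rewrite -ltnNge => my; have y0 : (0 < gdist G o y)%N by exact: leq_trans my.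
rewrite mem_set// -EFinM lee_fin /s opprB addrC powRD; last first.
  by rewrite pnatr_eq0 -lt0n y0 implybT.
rewrite mulrA ler_wpM2r ?powR_ge0//.
have /J_bnd/andP[_ //] : r <= (gdist G o y)%:R.
by rewrite ltW// (lt_le_trans rm)// ler_nat ltnW.
Qed.

End WeightedDegree.

(** * Edges leaving the balls of a dyadic window *)

Lemma component_restrict_mono (V : choiceType) (H : sgraph V)
    (B B' : {fset V}) (v : V) : (B `<=` B')%fset ->
  component (restrict_to H B) v `<=` component (restrict_to H B') v.
Proof.
move=> /fsubsetP BB'; apply: reachable_ind; first exact: reachable_refl.
move=> y z _ vy /and3P[Hyz yB zB]; apply: reachable_trans vy _.
by apply: reachable_adj; rewrite /= Hyz !BB'.
Qed.

Section Escape.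
Variables (R : realType) (V : choiceType) (G : sgraph V) (o : V) (d : nat).
Variables (J : V -> V -> R) (beta : R).
Hypothesis G_connected : connected_graph G.
Hypothesis G_dimension : has_dimension R G o d.
Hypothesis J_ge0 : forall x y, 0 <= J x y.
Hypothesis beta_ge0 : 0 <= beta.
Variables (theta M : R).
Hypothesis theta_ge0 : 0 <= theta.
Hypothesis M_ge0 : 0 <= M.
Hypothesis degree_le : forall x,
  (\esum_(y in [set: V]) (J x y * (gdist G x y)%:R `^ theta)%:E <= M%:E)%E.

Definition graph_ball (r : nat) : {fset V} := fset_set (gball G o r).

Lemma in_graph_ball (r : nat) (x : V) : (x \in graph_ball r) = (gdist G o x <= r)%N.
Proof.
rewrite in_fset_set; last exact: gball_finite G_dimension r.
by apply/idP/idP => [/set_mem|] //; rewrite inE.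
Qed.

(** The conditional mean number of open edges from [A] to the outside of the ball,
up to replacing [1 - exp (- beta J)] by [beta J]. *)
Definition escape (r : nat) (A : {fset V}) : \bar R :=
  \esum_(x in [set` A]) \esum_(y in ~` [set` graph_ball r]) (beta * J x y)%:E.

Lemma escape_ge0 (r : nat) (A : {fset V}) : (0 <= escape r A)%E.
Proof. by do 2!(apply: esum_ge0 => ? _); rewrite lee_fin mulr_ge0. Qed.

Let weight_ge0 x y : (0 <= (J x y * (gdist G x y)%:R `^ theta)%:E)%E.
Proof. by rewrite lee_fin mulr_ge0// powR_ge0. Qed.

Lemma esum_degree_le (A : {fset V}) (k : R) : 0 <= k ->
  (\esum_(x in [set` A]) \esum_(y in [set: V])
     (k%:E * (J x y * (gdist G x y)%:R `^ theta)%:E) <=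
   ((#|` A|)%:R * (k * M))%:E)%E.
Proof.
move=> k0; apply: (@le_trans _ _ (\esum_(x in [set` A]) (k * M)%:E)%E).
  apply: le_esum => x _; apply: le_trans (esum_leZl _ k0 (weight_ge0 x)) _.
  by rewrite EFinM lee_wpmul2l// lee_fin.
rewrite esum_fset//; last by move=> i _; rewrite lee_fin mulr_ge0.
rewrite fsbig_finite//= set_fsetK sumEFin big_const_seq count_predT.
by rewrite iter_addr addr0 mulr_natl.
Qed.

Lemma escape_fin_num (r : nat) (A : {fset V}) :
  (A `<=` graph_ball r)%fset -> escape r A \is a fin_num.
Proof.
move=> /fsubsetP AB; rewrite ge0_fin_numE ?escape_ge0//.
apply: le_lt_trans (ltry _); apply: le_trans (esum_degree_le A beta_ge0).
apply: le_esum => x /AB; rewrite in_graph_ball => xr.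
rewrite esum_mkcond; apply: le_esum => y _; case: ifPn; last first.
  by move=> _; rewrite -EFinM lee_fin !mulr_ge0// powR_ge0.
move=> /set_mem/negP; rewrite in_graph_ball -ltnNge => yr.
rewrite -EFinM lee_fin ler_wpM2l// ler_peMr//.
have xy : (1 <= gdist G x y)%N by have := gdist_triangle G_connected o x y; lia.
have xy1 : 1 <= (gdist G x y)%:R :> R by rewrite ler1n.
by have := ler_powR xy1 theta_ge0; rewrite powRr0.
Qed.

(** Exchanging sums, a pair of vertices counts once for each ball of the window
that separates it: at most [min (gdist G x y) m] times, which [min_le_powR]
turns into a weighted degree. *)
Lemma sum_escape_le (m : nat) (A : nat -> {fset V}) (A' : {fset V}) :
    (0 < m)%N -> theta <= 1 ->
    (forall r, (m <= r < m.*2)%N ->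
      (A r `<=` graph_ball r)%fset /\ (A r `<=` A')%fset) ->
  (\sum_(m <= r < m.*2) escape r (A r) <=
   ((#|` A'|)%:R * (beta * m%:R `^ (1 - theta) * M))%:E)%E.
Proof.
move=> m0 theta_le1 hA; have m0' : 0 < m%:R :> R by rewrite ltr0n.
pose ind (x y : V) (r : nat) : R := (gdist G o x <= r < gdist G o y)%N%:R.
have t0 x y r : (0 <= (beta * J x y * ind x y r)%:E)%E.
  by rewrite lee_fin !mulr_ge0// ler0n.
apply: (@le_trans _ _ (\sum_(m <= r < m.*2) \esum_(x in [set` A'])
    \esum_(y in [set: V]) (beta * J x y * ind x y r)%:E)%E).
  rewrite big_nat_cond [leRHS]big_nat_cond; apply: lee_sum => r /andP[mr _].
  have [/fsubsetP AB /fsubsetP AA'] := hA r mr.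
  rewrite /escape esum_mkcond [leRHS]esum_mkcond; apply: le_esum => x _.
  case: ifPn => [/set_mem xA|_]; last first.
    by case: ifP => // _; do !apply: esum_ge0 => ? _.
  rewrite mem_set; last exact: AA'.
  rewrite esum_mkcond; apply: le_esum => y _; case: ifPn => // /set_mem/negP.
  rewrite in_graph_ball -ltnNge => yr; rewrite /ind yr andbT.
  by have := AB _ xA; rewrite in_graph_ball => ->; rewrite mulr1.
rewrite -esum_sum; last by move=> x r _ _; apply: esum_ge0 => ? _.
have k0 : 0 <= beta * m%:R `^ (1 - theta) by rewrite mulr_ge0// powR_ge0.
apply: le_trans (esum_degree_le A' k0); apply: le_esum => x _.
rewrite -esum_sum; last by move=> y r _ _.
apply: le_esum => y _; rewrite sumEFin -EFinM lee_fin -mulr_sumr -natr_sum.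
rewrite -!mulrA ler_wpM2l// [leRHS]mulrCA ler_wpM2l//.
apply: (@le_trans _ _ (Num.min (gdist G x y)%:R m%:R)); last first.
  by apply: min_le_powR; rewrite ?theta_ge0.
rewrite le_min !ler_nat; apply/andP; split.
  apply: leq_trans (sum_window_le _ _ _ _) _.
  by have := gdist_triangle G_connected o x y; lia.
apply: (@leq_trans (\sum_(m <= r < m.*2) 1)%N).
  by apply: leq_sum => r _; case: (_ && _).
by rewrite sum_nat_const_nat muln1; lia.
Qed.

End Escape.

(** * Growth of the cluster between dyadic scales *)

Section Contradiction.
Variables (R : realType) (V : choiceType) (G : sgraph V) (o : V) (d : nat).
Variables (J : V -> V -> R) (beta : R).
Hypothesis G_connected : connected_graph G.
Hypothesis G_dimension : has_dimension R G o d.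
Hypothesis J_ge0 : forall x y, 0 <= J x y.
Hypothesis beta_ge0 : 0 <= beta.

(** The second term makes the denominator positive; over a dyadic window these
terms add up to at most [1]. *)
Definition expected_boundary (r : nat) (A : {fset V}) : R :=
  fine (escape G o J beta r A) + r.+1%:R^-1.

Lemma expected_boundary_gt0 (r : nat) (A : {fset V}) :
  0 < expected_boundary r A.
Proof. by rewrite ltr_wpDl ?invr_gt0// fine_ge0// escape_ge0. Qed.

Variables (H : sgraph V) (v : V).

Definition cluster_in_ball (r : nat) : {fset V} :=
  fset_set (component (restrict_to H (graph_ball G o r)) v).

Let A := cluster_in_ball.

Lemma set_cluster_in_ball (r : nat) : (gdist G o v <= r)%N ->
  [set` A r] = component (restrict_to H (graph_ball G o r)) v.
Proof.
move=> vr; rewrite fset_setK//; apply: finite_component_restrict.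
by rewrite (in_graph_ball G_dimension).
Qed.

Lemma cluster_in_ball_sub (r : nat) : (gdist G o v <= r)%N ->
  (A r `<=` graph_ball G o r)%fset.
Proof.
move=> vr; apply/fsubsetP => x xA.
have : [set` A r] x by [].
rewrite set_cluster_in_ball// => /component_restrict_sub; apply.
by rewrite (in_graph_ball G_dimension).
Qed.

Lemma cluster_in_ball_mono (r r' : nat) : (gdist G o v <= r)%N -> (r <= r')%N ->
  (A r `<=` A r')%fset.
Proof.
move=> vr rr'; apply/fsubsetP => x xA.
have : [set` A r] x by [].
rewrite set_cluster_in_ball// => xr.
suff : [set` A r'] x by [].
rewrite set_cluster_in_ball; last exact: leq_trans rr'.
apply: component_restrict_mono xr; apply/fsubsetP => z.
by rewrite !(in_graph_ball G_dimension) => /leq_trans; apply.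
Qed.

Lemma boundary_ratio_cluster_ge (r : nat) (b : R) : (gdist G o v <= r)%N ->
    (b%:E <= crossing R H (graph_ball G o r) (A r))%E ->
  (((expected_boundary r (A r))^-1 * b)%:E <=
   boundary_ratio (graph_ball G o r) v (expected_boundary r) H)%E.
Proof.
move=> vr b_le; have Ar : A r \in fpowerset (graph_ball G o r).
  by rewrite fpowersetE cluster_in_ball_sub.
rewrite /boundary_ratio (big_fsetD1 _ Ar)/=.
apply: (@le_trans _ _ ((expected_boundary r (A r))^-1%:E *
   ((\1_(component_is (graph_ball G o r) v (A r)) H)%:E *
     crossing R H (graph_ball G o r) (A r)))%E); last first.
  rewrite leeDl//; apply: sume_ge0 => B _; apply: mule_ge0.
    by rewrite lee_fin invr_ge0 ltW// expected_boundary_gt0.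
  by apply: mule_ge0; [rewrite lee_fin|exact: crossing_ge0].
rewrite indicE mem_set ?mul1e; last by rewrite /component_is /= -set_cluster_in_ball.
by rewrite EFinM lee_wpmul2l// lee_fin invr_ge0 ltW// expected_boundary_gt0.
Qed.

Section Growth.
Variables (theta M : R).
Hypothesis theta_bnd : 0 <= theta <= 1.
Hypothesis M_ge0 : 0 <= M.
Hypothesis degree_le : forall x,
  (\esum_(y in [set: V]) (J x y * (gdist G x y)%:R `^ theta)%:E <= M%:E)%E.

Lemma cluster_in_ball_ge1 (r : nat) : (gdist G o v <= r)%N ->
  (1 <= #|` A r|)%N.
Proof.
move=> vr; rewrite cardfs_gt0; apply/fset0Pn; exists v.
suff : [set` A r] v by [].
by rewrite set_cluster_in_ball//; exact: reachable_refl.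
Qed.

(** The term [1] coming from the small summands is absorbed since the cluster is
not empty and [theta <= 1]. *)
Lemma sum_expected_boundary_le (n : nat) : (gdist G o v <= 2 ^ n)%N ->
  \sum_(2 ^ n <= r < 2 ^ n.+1) expected_boundary r (A r) <=
  (2 ^ n)%:R * ((#|` A (2 ^ n.+1)|)%:R * (beta * M + 1) *
                ((2 `^ theta) ^+ n)^-1).
Proof.
move=> vn; have /andP[theta0 theta1] := theta_bnd.
set m := (2 ^ n)%N; set N := (#|` A (2 ^ n.+1)|)%:R.
have m0 : (0 < m)%N by rewrite expn_gt0.
have m2 : (2 ^ n.+1 = m.*2)%N by rewrite expnS mul2n.
have N1 : 1 <= N.
  by rewrite ler1n cluster_in_ball_ge1// (leq_trans vn)// leq_pexp2l.
have vr r : (m <= r < m.*2)%N -> (gdist G o v <= r)%N.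
  by move=> /andP[mr _]; exact: leq_trans mr.
have sub r : (m <= r < m.*2)%N -> (A r `<=` graph_ball G o r)%fset /\
    (A r `<=` A (2 ^ n.+1)%N)%fset.
  move=> mr; split; first exact: cluster_in_ball_sub (vr _ mr).
  by apply: cluster_in_ball_mono (vr _ mr) _; rewrite m2; lia.
have esc := sum_escape_le G_connected G_dimension J_ge0 beta_ge0
  theta0 M_ge0 degree_le m0 theta1 sub.
have esc_fin r : (m <= r < m.*2)%N ->
    (fine (escape G o J beta r (A r)))%:E = escape G o J beta r (A r).
  move=> mr; rewrite fineK//.
  exact: (escape_fin_num G_connected G_dimension J_ge0 beta_ge0 theta0 M_ge0
    degree_le (sub r mr).1).
have {esc}fine_esc : \sum_(m <= r < m.*2) fine (escape G o J beta r (A r)) <=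
    N * (beta * m%:R `^ (1 - theta) * M).
  rewrite -lee_fin -sumEFin; apply: le_trans esc.
  rewrite le_eqVlt; apply/orP; left; apply/eqP.
  by rewrite big_nat_cond [RHS]big_nat_cond; apply: eq_bigr => r /andP[/esc_fin].
have small : \sum_(m <= r < m.*2) (r.+1%:R^-1 : R) <= 1.
  apply: (@le_trans _ _ (\sum_(m <= r < m.*2) (m%:R^-1 : R))).
    rewrite big_nat_cond [leRHS]big_nat_cond.
    apply: ler_sum => r /andP[/andP[mr _] _].
    by rewrite lef_pV2 ?posrE ?ltr0n// ler_nat ltnW.
  rewrite big_const_nat iter_addr addr0 -addnn addnK -[leLHS]mulr_natl mulfV//.
  by rewrite pnatr_eq0 -lt0n.
have powm : m%:R * ((2 `^ theta) ^+ n)^-1 = m%:R `^ (1 - theta) :> R.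
  rewrite powRB; last by rewrite pnatr_eq0 -lt0n m0 implybT.
  rewrite powRr1// -powR_mulrn ?powR_ge0// -powRrM (mulrC theta) powRrM powR_mulrn//.
  by rewrite /m natrX.
have powm1 : 1 <= m%:R `^ (1 - theta) :> R.
  have m1 : 1 <= m%:R :> R by rewrite ler1n.
  have := ler_powR m1 (_ : 0 <= 1 - theta).
  by rewrite powRr0; apply; rewrite subr_ge0.
rewrite m2 big_split/= mulrCA powm mulrDr mulr1.
have -> : (N * (beta * M) + N) * m%:R `^ (1 - theta) =
    N * (beta * m%:R `^ (1 - theta) * M) + N * m%:R `^ (1 - theta).
  by rewrite mulrDl -!mulrA (mulrC M).
apply: lerD => //; apply: le_trans small _.
by rewrite -[leLHS]mulr1 ler_pM.
Qed.

(** If every boundary in the window has at least [b] edges, the ratios are at least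
[b / expected_boundary], whose sum is bounded below by convexity and above by
hypothesis. *)
Lemma cluster_growth (n : nat) (b t rho : R) : (gdist G o v <= 2 ^ n)%N ->
    0 <= b -> 0 < t -> 0 < rho ->
    (forall r, (2 ^ n <= r < 2 ^ n.+1)%N ->
       (b%:E <= crossing R H (graph_ball G o r) (A r))%E) ->
    (\sum_(2 ^ n <= r < 2 ^ n.+1)
       boundary_ratio (graph_ball G o r) v (expected_boundary r) H <=
     (t * 2 ^+ n / rho ^+ n)%:E)%E ->
  (t * (beta * M + 1))^-1 * (2 `^ theta * rho) ^+ n * b <=
    (#|` A (2 ^ n.+1)|)%:R.
Proof.
move=> vn b0 t0 rho0 b_le ratio_le.
set N : R := (#|` A (2 ^ n.+1)|)%:R.
have N0 : 0 < N.
  by rewrite ltr0n cluster_in_ball_ge1// (leq_trans vn)// leq_pexp2l.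
have bM : 0 < beta * M + 1 by rewrite ltr_wpDl// mulr_ge0.
pose lambda := N * (beta * M + 1) * ((2 `^ theta) ^+ n)^-1.
have l0 : 0 < lambda.
  by rewrite mulr_gt0 ?mulr_gt0// invr_gt0 exprn_gt0// powR_gt0.
have size_eq : size (index_iota (2 ^ n) (2 ^ n.+1)) = (2 ^ n)%N.
  by rewrite size_iota expnS mul2n -addnn addnK.
have := @sum_inv_ge R _ (index_iota (2 ^ n) (2 ^ n.+1))
  (fun r => expected_boundary r (A r)) lambda
  (fun r => expected_boundary_gt0 r (A r)) l0.
rewrite size_eq => /(_ (sum_expected_boundary_le vn)) inv_ge.
have : (2 ^ n)%:R / lambda * b <= t * 2 ^+ n / rho ^+ n.
  apply: (le_trans (ler_wpM2r b0 inv_ge)).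
  rewrite -lee_fin; apply: le_trans ratio_le.
  rewrite mulr_suml -sumEFin big_nat_cond [leRHS]big_nat_cond.
  apply: lee_sum => r /andP[nr _].
  apply: boundary_ratio_cluster_ge; last exact: b_le.
  by case/andP: nr => nr _; exact: leq_trans nr.
rewrite natrX (mulrC t) -!mulrA ler_pM2l ?exprn_gt0//.
set P := (2 `^ theta) ^+ n; set B := beta * M + 1.
have P0 : 0 < P by rewrite exprn_gt0// powR_gt0.
have -> : lambda^-1 = N^-1 * B^-1 * P by rewrite /lambda !invfM invrK.
rewrite exprMn -/P ler_pdivlMr ?exprn_gt0// -(ler_pM2l N0).
rewrite !mulrA mulfV ?gt_eqF// mul1r => le_tN.
rewrite invfM -!mulrA ler_pdivrMl// (mulrC t); apply: le_trans le_tN.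
by rewrite (mulrC _ b) !mulrA.
Qed.

End Growth.
End Contradiction.

(** * The isoperimetric dimension of a cluster *)

Section Dimension.
Variables (R : realType) (V : choiceType) (G : sgraph V) (o : V) (d : nat).
Variables (J : V -> V -> R) (alpha beta : R).
Hypothesis G_connected : connected_graph G.
Hypothesis G_transitive : transitive_graph G.
Hypothesis d_ge1 : (1 <= d)%N.
Hypothesis G_dimension : has_dimension R G o d.
Hypothesis J_transitive : transitive_kernel G J.
Hypothesis alpha_gt1 : 1 < alpha.
Hypothesis J_Theta : kernel_Theta G J (- (d%:R * alpha)).
Hypothesis beta_ge0 : 0 <= beta.

Let J_ge0 x y : 0 <= J x y. Proof. by have [] := J_transitive. Qed.

(** A sequence in the open unit interval with limit [1] and explicit logarithms. *)
Let rho (k : nat) : R := expR (- k.+1%:R^-1).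

(** The almost sure property of the configuration from which the bound on the
dimension is deduced. *)
Definition tame (v : V) (H : sgraph V) : Prop :=
  forall k : nat, exists2 t : R, 0 < t & forall n,
    (\sum_(2 ^ n <= r < 2 ^ n.+1)
       boundary_ratio (graph_ball G o r) v (expected_boundary G o J beta r) H <=
     (t * 2 ^+ n / rho k ^+ n)%:E)%E.

(** If [D] exceeded the bound, some [theta] strictly between [d / D] and
[min 1 (d * (alpha - 1))] would be admissible, and with [rho k] close enough to
[1] the recursion of [cluster_growth] would contradict the polynomial growth of
[G]. *)
Lemma isoperimetric_dimension_le (H : sgraph V) (K : set V) (v : K) (c D : R) :
    (forall x y, K x -> H x y -> K y) -> tame (val v) H -> 0 < c -> 0 < D ->
    (forall W : set K, finite_set W -> connected_in (subgraph H K) W -> W v ->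
      (c%:E * counting W `^ ((D - 1) / D) <=
       counting (edge_boundary (subgraph H K) W))%E) ->
  D <= Num.max (alpha - 1)^-1 d%:R.
Proof.
move=> K_closed H_tame c0 D0 isop; rewrite leNgt; apply/negP.
rewrite gt_max => /andP[D_alpha D_d].
have d0 : 0 < d%:R :> R by rewrite ltr0n.
have D1 : 1 < D by apply: le_lt_trans D_d; rewrite ler1n.
have a0 : 0 < alpha - 1 by rewrite subr_gt0.
pose p := (D - 1) / D.
have p0 : 0 <= p by rewrite divr_ge0// ltW// subr_gt0.
have p1E : 1 - p = D^-1 by rewrite /p mulrBl mulfV ?gt_eqF// mul1r subKr.
have p1 : p < 1 by rewrite -subr_gt0 p1E invr_gt0.
pose theta_max := Num.min 1 (d%:R * (alpha - 1)).
have dD_max : d%:R / D < theta_max.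
  rewrite lt_min ltr_pdivrMr// mul1r D_d/= ltr_pM2l//.
  by rewrite -[ltRHS]invrK ltf_pV2// posrE invr_gt0.
(* Any point strictly between the two bounds would do. *)
pose theta := (d%:R / D + theta_max) / 2.
have dD0 : 0 < d%:R / D by rewrite divr_gt0.
have theta_gt : d%:R / D < theta by rewrite /theta; lra.
have theta_lt : theta < theta_max by rewrite /theta; lra.
have theta1 : 0 <= theta <= 1.
  move: theta_lt; rewrite lt_min => /andP[/ltW-> _]; rewrite andbT ltW//.
  exact: lt_trans theta_gt.
have thetaa : 0 < theta < d%:R * (alpha - 1).
  move: theta_lt; rewrite lt_min => /andP[_ ->]; rewrite andbT.
  exact: lt_trans theta_gt.
have [M M0 M_deg] := weighted_degree_bound G_connected G_transitive G_dimension
  J_transitive J_Theta thetaa.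
have ln2 : 0 < ln 2 :> R by rewrite ln_gt0// ltr1n.
pose gap := (theta - d%:R / D) * ln 2.
have gap0 : 0 < gap by rewrite mulr_gt0// subr_gt0.
(* [- ln (rho k)] is the inverse of [k.+1] and has to be smaller than [gap]. *)
pose k := Num.trunc gap^-1.
have k_gap : k.+1%:R^-1 < gap.
  by rewrite -[ltRHS]invrK ltf_pV2 ?posrE ?invr_gt0// truncnS_gt.
have [t t0 t_bnd] := H_tame k.
have rho0 : 0 < rho k by exact: expR_gt0.
pose A := cluster_in_ball G o H (val v).
pose N (n : nat) : R := (#|` A (2 ^ n)%N|)%:R.
have iso r : (gdist G o (val v) <= r)%N ->
    ((c * (#|` A r|)%:R `^ p)%:E <= crossing R H (graph_ball G o r) (A r))%E.
  move=> vr.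
  have vB : val v \in graph_ball G o r by rewrite (in_graph_ball G_dimension).
  have finW := cluster_component_finite H vB.
  have := isop _ finW (cluster_component_connected K_closed)
    (reachable_refl _ _).
  move=> /le_trans /(_ (counting_edge_boundary R H vB)).
  rewrite /crossing (set_cluster_in_ball G_dimension)//; apply: le_trans.
  rewrite EFinM; apply: lee_wpmul2l; first by rewrite lee_fin ltW.
  have finC := finite_component_restrict H vB.
  have := @counting_cluster_component R _ H (graph_ball G o r) K v K_closed.
  rewrite (counting_finite R finC) (counting_finite R finW) lee_fin => NW.
  by rewrite poweR_EFin lee_fin ge0_ler_powR ?nnegrE.
have small_v n : (gdist G o (val v) <= n)%N -> (gdist G o (val v) <= 2 ^ n)%N.
  by move=> /leq_trans; apply; exact/ltnW/ltn_expl.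
have [c_ball [C [_ C0 ball_le]]] := G_dimension.
have kappa0 : 0 < (t * (beta * M + 1))^-1 * c.
  by rewrite mulr_gt0// invr_gt0 mulr_gt0// ltr_wpDl// mulr_ge0.
apply: (@recursion_contradiction R N (gdist G o (val v)) d C _
  (2 `^ theta * rho k) p C0 kappa0).
- by rewrite mulr_gt0// powR_gt0.
- by rewrite p0.
- rewrite p1E lnM ?posrE ?powR_gt0// ln_powR /rho expRK.
  have -> : D^-1 * (d%:R * ln 2) = d%:R / D * ln 2 by rewrite mulrA (mulrC D^-1).
  by rewrite ltrBrDr -ltrBrDl -mulrBl.
- move=> n /small_v vn; rewrite /N ler1n (cluster_in_ball_ge1 G_dimension)//=.
  have n0 : (0 < 2 ^ n)%N by rewrite expn_gt0.
  have [_] := ball_le _ n0.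
  rewrite counting_finite; last exact: (gball_finite G_dimension).
  rewrite lee_fin natrX; apply: le_trans.
  by rewrite ler_nat fsubset_leq_card// (cluster_in_ball_sub G_dimension).
- move=> n /small_v vn.
  rewrite (mulrAC _ c) -(mulrA _ c).
  apply: (cluster_growth G_connected G_dimension J_ge0 beta_ge0 theta1 M0 M_deg vn
    _ t0 rho0) => //.
  + by rewrite mulr_ge0 ?powR_ge0 ?ltW.
  + move=> r /andP[nr _]; have vr := leq_trans vn nr.
    have NA : N n <= (#|` A r|)%:R.
      rewrite /N ler_nat; apply: fsubset_leq_card.
      exact: (cluster_in_ball_mono G_dimension).
    have Np : N n `^ p <= (#|` A r|)%:R `^ p.
      by apply: (ge0_ler_powR p0 _ _ NA); rewrite nnegrE ler0n.
    by apply: le_trans (iso r vr); rewrite lee_fin ler_wpM2l// ltW.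
Qed.

End Dimension.

(** * The almost sure bound *)

Lemma ae_forall_countable (d : measure_display) (T : measurableType d)
    (R : realType) (mu : {measure set T -> \bar R}) (I : Type)
    (Q : I -> T -> Prop) : countable [set: I] ->
  (forall i, {ae mu, forall x, Q i x}) -> {ae mu, forall x, forall i, Q i x}.
Proof.
move=> /countable_injP[e e_inj] aeQ.
have : {ae mu, forall x, forall n i, e i = n -> Q i x}.
  apply: ae_foralln => n.
  have [[i ein]|nex] := pselect (exists i, e i = n); last first.
    by apply: aeW => x i ein; exfalso; apply: nex; exists i.
  apply: filterS (aeQ i) => x Qix j ejn.
  by rewrite (e_inj j i) ?inE// ejn.
by apply: filterS => x Qx i; exact: (Qx (e i)).
Qed.

(** Any admissible exponent shows that the expected boundaries are finite. *)
Lemma ae_tame (R : realType) (V : choiceType) (G : sgraph V) (o : V) (d : nat)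
    (J : V -> V -> R) (alpha beta : R) (P : probability (sgraph V) R) :
    connected_graph G -> transitive_graph G -> (1 <= d)%N ->
    has_dimension R G o d -> transitive_kernel G J -> 1 < alpha ->
    kernel_Theta G J (- (d%:R * alpha)) -> 0 <= beta ->
    percolation_law J beta P ->
  {ae P, forall H, forall v, tame G o J beta v H}.
Proof.
move=> G_conn G_trans d1 G_dim J_trans alpha1 J_Th beta0 P_law.
have V_countable := countable_vertices G_dim.
have J_ge0 x y : 0 <= J x y by have [] := J_trans.
pose theta := d%:R * (alpha - 1) / 2.
have da0 : 0 < d%:R * (alpha - 1) by rewrite mulr_gt0 ?ltr0n// subr_gt0.
have theta0 : 0 < theta by rewrite divr_gt0.
have thetaE : 0 < theta < d%:R * (alpha - 1) by rewrite theta0/= /theta; lra.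
have [M M0 M_deg] := weighted_degree_bound G_conn G_trans G_dim J_trans J_Th thetaE.
apply: ae_forall_countable => // v; apply: ae_foralln => k.
apply: (ae_boundary_ratio_le V_countable beta0 J_ge0 P_law).
- by rewrite expR_gt0 expR_lt1 oppr_lt0 invr_gt0 ltr0n.
- by move=> r A; exact: expected_boundary_gt0.
- move=> r A AB; have := escape_fin_num G_conn G_dim J_ge0 beta0 (ltW theta0) M0 M_deg AB.
  move=> fin_esc; rewrite -[leLHS]/(escape G o J beta r A) -(fineK fin_esc) lee_fin.
  by rewrite lerDl invr_ge0.
Qed.

Theorem theorem1p8 (R : realType) (V : choiceType) (G : sgraph V) (o : V)
    (d : nat) (J : V -> V -> R) (alpha : R)
    (P : R -> probability (sgraph V) R) (beta : R)
    (V_infinite : infinite_set [set: V])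
    (G_connected : connected_graph G)
    (G_locally_finite : locally_finite G)
    (G_transitive : transitive_graph G)
    (d_ge1 : (1 <= d)%N)
    (G_dimension : has_dimension R G o d)
    (J_transitive : transitive_kernel G J)
    (alpha_range : 1 < alpha < 2)
    (J_Theta : kernel_Theta G J (- (d%:R * alpha)))
    (P_law : forall b : R, 0 <= b -> percolation_law J b (P b))
    (beta_gt : (beta_c o P < beta%:E)%E) :
  {ae P beta, forall H : sgraph V, forall K : set V, infinite_cluster H K ->
    (anchored_dimension R (subgraph H K)
       <= (Num.max (alpha - 1)^-1 d%:R)%:E)%E}.
Proof.
have beta_ge0 : 0 <= beta.
  have [_ [b [b0 _] <-]] := ereal_inf_lt beta_gt.
  by rewrite lte_fin => /ltW; exact: le_trans.
have /andP[alpha_gt1 _] := alpha_range.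
apply: filterS (ae_tame G_connected G_transitive d_ge1 G_dimension J_transitive
  alpha_gt1 J_Theta beta_ge0 (P_law beta beta_ge0)) => H H_tame K [_ [x0 KE]].
apply: ge_ereal_sup => _ [D [D0 [v [c c0 isop]]] <-]; rewrite lee_fin.
apply: (isoperimetric_dimension_le G_connected G_transitive d_ge1 G_dimension
  J_transitive alpha_gt1 J_Theta beta_ge0 _ (H_tame (val v)) c0 D0 isop).
move=> x y; rewrite KE => x0x xy.
exact: reachable_trans x0x (reachable_adj xy).
Qed.
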